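(* Let $k=2\ell+1$ with $\ell\ge 1$ an integer, let $a\ge 0$, write $\mathbf{x}=(x_1,\ldots,x_{2\ell+1})$, and consider the $k$-dimensional Lyness' map $F:\mathcal{Q}^+\to\mathcal{Q}^+$, $$F(x_1,\ldots,x_k)=\left(x_2,\ldots,x_k,\frac{a+\sum_{i=2}^{k}x_i}{x_1}\right).$$ Then: (a) The function $$W(\mathbf{x})=\frac{\prod_{j=0}^{\ell}(x_{2j+1}+1)}{\prod_{j=1}^{\ell}x_{2j}}$$ is a first integral of $F^2=F\circ F$. (b) For any $\ell\ge 2$, the function $V_3:=W+W(F)$, which is $$V_3(\mathbf{x})=\frac{\prod_{j=0}^{\ell}x_{2j+1}(x_{2j+1}+1)+\left(a+\sum_{j=1}^{2\ell+1}x_j\right)\prod_{j=1}^{\ell}x_{2j}(x_{2j}+1)}{\prod_{i=1}^{2\ell+1}x_i},$$ is a first integral of $F$ which is functionally independent with the first integrals $V_1$ and $V_2$ of $F$ given by $$V_1(\mathbf{x})=\frac{\left(a+\sum_{i=1}^k x_i\right)\prod_{i=1}^{k}(x_i+1)}{x_1\cdots x_k},\qquad V_2(\mathbf{x})=\frac{\left(a+\sum_{i=1}^k x_i+x_1x_k\right)\prod_{i=1}^{k-1}(1+x_i+x_{i+1})}{x_1\cdots x_k}.$$ (c) $V_1=W\cdot W(F)$. (d) The algebraic set $\mathcal{G}:=\{\mathbf{x}\in\mathcal{Q}^+ : W(\mathbf{x})-W(F(\mathbf{x}))=0\}$ is invariant by $F$. (e) If the map $F$ has some periodic point of odd period (in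 $\mathcal{Q}^+$), then it has to be contained in $\mathcal{G}$. (f) Setting $\mathcal{G}^{\pm}:=\{\mathbf{x}\in\mathcal{Q}^+ : \pm(W(\mathbf{x})-W(F(\mathbf{x})))>0\}$, the map $F$ sends $\mathcal{G}^{+}$ into $\mathcal{G}^{-}$ and vice versa, and both sets are invariant by $F^2$. Furthermore, the dynamics of $F^2$ on $\mathcal{G}^+$ and on $\mathcal{G}^-$ are conjugated, the map $F$ itself being the conjugation. (g) The measure $$m_1(B):=\int_{B}\frac{\pm1}{\Pi(\mathbf{x})\,(W(\mathbf{x})-W(F(\mathbf{x})))}\,d\mathbf{x},\qquad \Pi(\mathbf{x})=\prod_{i=1}^k x_i,$$ (sign $+$ on $\mathcal{G}^+$ and sign $-$ on $\mathcal{G}^-$) is an invariant measure for $F^2$, i.e. $m_1(F^2(B))=m_1(B)$ for any measurable set $B$ in $\mathcal{G}^{\pm}$. (h) The measure $$m_2(B):=\int_{B}\frac{1}{\Pi(\mathbf{x})}\,d\mathbf{x}$$ is an invariant measure for $F^2$, i.e. $m_2(F^2(B))=m_2(B)$ for any measurable set $B$ in $\mathcal{Q}^+$.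
   Context: $\mathcal{Q}^+=\{\mathbf{x}=(x_1,\ldots,x_k)\in\mathbb{R}^k : x_1>0,\ldots,x_k>0\}$; $F$ is a diffeomorphism of $\mathcal{Q}^+$ onto itself. A first integral of a map $G$ of $\mathcal{Q}^+$ is a (non-constant) function $V:\mathcal{Q}^+\to\mathbb{R}$ with $V(G(\mathbf{x}))=V(\mathbf{x})$ for all $\mathbf{x}\in\mathcal{Q}^+$. The notation $W(F)$ means $W\circ F$. Functional independence is meant in the usual sense: the gradients of the functions are linearly independent on a dense open subset of $\mathcal{Q}^+$. *)

(* Defs.v *)
(* MathComp-Analysis; the reals are an arbitrary [R : realType]. *)
From HB Require Import structures.
From mathcomp Require Import all_boot all_order all_algebra.
From mathcomp Require Import all_classical all_reals all_analysis.

Set Implicit Arguments.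
Unset Strict Implicit.
Unset Printing Implicit Defensive.

Import Order.TTheory GRing.Theory Num.Theory.
Import numFieldNormedType.Exports.

Local Open Scope classical_set_scope.
Local Open Scope ring_scope.

(* Borel sigma-algebra of R^n, as the product sigma-algebra (same construction
   as the library's instance for [n.-tuple T]). *)
Definition measure_rV_display : measure_display -> measure_display.
Proof. exact. Qed.

Section measurable_rV.
Context {R : realType} (n : nat).

Definition coor_rV (i : 'I_n) (v : 'rV[R]_n) : measurableTypeR R := v ord0 i.

Let rV_set0 : g_sigma_preimage coor_rV set0.
Proof. exact: sigma_algebra0. Qed.

Let rV_setC A : g_sigma_preimage coor_rV A -> g_sigma_preimage coor_rV (~` A).
Proof. exact: sigma_algebraC. Qed.

Let rV_bigcup (F : (set 'rV[R]_n)^nat) :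
  (forall i, g_sigma_preimage coor_rV (F i)) ->
  g_sigma_preimage coor_rV (\bigcup_i (F i)).
Proof. exact: sigma_algebra_bigcup. Qed.

HB.instance Definition _ := @isMeasurable.Build
  (measure_rV_display default_measure_display) ('rV[R]_n)
  (g_sigma_preimage coor_rV) rV_set0 rV_setC rV_bigcup.

End measurable_rV.

Lemma measurable_coor_rV (R : realType) (n : nat) (i : 'I_n) :
  measurable_fun [set: 'rV[R]_n] (coor_rV i).
Proof.
move=> _ Y mY; rewrite setTI; apply: sub_sigma_algebra => /=.
rewrite -bigcup_seq/=; exists i => /=; first by rewrite mem_index_enum.
by exists Y => //; rewrite setTI.
Qed.

Lemma measurable_fun_rVP d (T : measurableType d) (R : realType) (n : nat)
    (f : T -> 'rV[R]_n) :
  measurable_fun [set: T] f <->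
  forall i, measurable_fun [set: T] (coor_rV i \o f).
Proof.
split=> [mf i|mf].
  by apply: measurableT_comp => //; exact: measurable_coor_rV.
have sub : g_sigma_preimage (fun i => coor_rV i \o f) `<=` measurable.
  apply: smallest_sub; first exact: sigma_algebra_measurable.
  rewrite -bigcup_seq; apply: bigcup_sub => i _.
  by move=> A [B mB <-]; exact: mf.
move=> _ A mA; apply: sub.
by rewrite g_sigma_preimage_comp; exists A.
Qed.

Section cons_rV.
Context {R : realType} (n : nat).

Definition cons_rV (p : measurableTypeR R * 'rV[R]_n) : 'rV[R]_n.+1 :=
  \row_j if unlift ord0 j is Some i then p.2 ord0 i else p.1.

Definition uncons_rV (v : 'rV[R]_n.+1) : measurableTypeR R * 'rV[R]_n :=
  (v ord0 ord0, \row_j v ord0 (lift ord0 j)).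

Lemma coor_cons_rV0 p : cons_rV p ord0 ord0 = p.1.
Proof. by rewrite mxE unlift_none. Qed.

Lemma coor_cons_rVS p (j : 'I_n) : cons_rV p ord0 (lift ord0 j) = p.2 ord0 j.
Proof. by rewrite mxE liftK. Qed.

Lemma cons_rVK : cancel cons_rV uncons_rV.
Proof.
move=> [x v]; rewrite /uncons_rV coor_cons_rV0; congr pair.
by apply/rowP => j; rewrite mxE coor_cons_rVS.
Qed.

Lemma uncons_rVK : cancel uncons_rV cons_rV.
Proof.
move=> v; apply/rowP => i; case: (unliftP ord0 i) => [j ->|->].
  by rewrite coor_cons_rVS mxE.
by rewrite coor_cons_rV0.
Qed.

Lemma measurable_cons_rV : measurable_fun [set: _] cons_rV.
Proof.
apply/measurable_fun_rVP => i; case: (unliftP ord0 i) => [j ->|->].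
  rewrite (_ : _ \o _ = coor_rV j \o snd).
    by apply: measurableT_comp => //; exact: measurable_coor_rV.
  by apply/funext => p; exact: coor_cons_rVS.
rewrite (_ : _ \o _ = fst) //.
by apply/funext => p; exact: coor_cons_rV0.
Qed.

Lemma measurable_uncons_rV : measurable_fun [set: _] uncons_rV.
Proof.
apply: measurable_fun_pair => /=; first exact: (measurable_coor_rV (ord0 : 'I_n.+1)).
apply/measurable_fun_rVP => j.
rewrite (_ : _ \o _ = coor_rV (lift ord0 j)); first exact: measurable_coor_rV.
by apply/funext => v; rewrite /coor_rV /= mxE.
Qed.

End cons_rV.

(* The library proves this instance but does not export it. *)
Lemma product_measure1_sigma_finite d1 d2 (T1 : measurableType d1)
    (T2 : measurableType d2) (R : realType)
    (m1 : {sigma_finite_measure set T1 -> \bar R})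
    (m2 : {sigma_finite_measure set T2 -> \bar R}) :
  sigma_finite setT (m1 \x m2)%E.
Proof.
have /sigma_finiteP[F [TF ndF Foo]] := sigma_finiteT m1.
have /sigma_finiteP[G [TG ndG Goo]] := sigma_finiteT m2.
exists (fun n => F n `*` G n).
  rewrite -setXTT TF TG predeqE => -[x y]; split.
    move=> [/= [n _ Fnx] [k _ Gky]]; exists (maxn n k) => //; split.
    - by move: x Fnx; exact/subsetPset/ndF/leq_maxl.
    - by move: y Gky; exact/subsetPset/ndG/leq_maxr.
  by move=> [n _ []/= ? ?]; split; exists n.
move=> k; have [? ?] := Foo k; have [? ?] := Goo k.
split; first exact: measurableX.
by rewrite product_measure1E// lte_mul_pinfty// ge0_fin_numE.
Qed.

Section lebesgue_cons.
Context {R : realType} (n : nat).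
Variable mu : {sigma_finite_measure set 'rV[R]_n -> \bar R}.
Local Open Scope ereal_scope.

Definition lebesgue_cons : set 'rV[R]_n.+1 -> \bar R :=
  pushforward (@lebesgue_measure R \x mu) (@cons_rV R n).

Let lebesgue_cons0 : lebesgue_cons set0 = 0.
Proof. by rewrite /lebesgue_cons /pushforward preimage_set0 measure0. Qed.

Let lebesgue_cons_ge0 A : 0 <= lebesgue_cons A.
Proof. by rewrite /lebesgue_cons /pushforward measure_ge0. Qed.

Let lebesgue_cons_sigma_additive : semi_sigma_additive lebesgue_cons.
Proof.
move=> F mF tF mUF; rewrite /lebesgue_cons /pushforward preimage_bigcup.
apply: measure_semi_sigma_additive.
- by move=> i; rewrite -[X in measurable X]setTI; exact: measurable_cons_rV.
- apply/trivIsetP => /= i j _ _ ij; rewrite -preimage_setI.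
  by move/trivIsetP : tF => /(_ _ _ _ _ ij) ->//; rewrite preimage_set0.
- by rewrite -preimage_bigcup -[X in measurable X]setTI;
    exact: measurable_cons_rV.
Qed.

HB.instance Definition _ := isMeasure.Build _ _ _ lebesgue_cons
  lebesgue_cons0 lebesgue_cons_ge0 lebesgue_cons_sigma_additive.

Let lebesgue_cons_sigma_finite : sigma_finite setT lebesgue_cons.
Proof.
have [F TF mF] := product_measure1_sigma_finite (@lebesgue_measure R) mu.
exists (fun i => @uncons_rV R n @^-1` F i).
  by rewrite -preimage_bigcup -TF preimage_setT.
move=> i; have [mFi Fioo] := mF i; split.
  by rewrite -[X in measurable X]setTI; exact: measurable_uncons_rV.
rewrite /lebesgue_cons /pushforward -comp_preimage.
rewrite (_ : _ \o _ = id) ?preimage_id//.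
by apply/funext => p; exact: cons_rVK.
Qed.

HB.instance Definition _ := Measure_isSigmaFinite.Build _ _ _ lebesgue_cons
  lebesgue_cons_sigma_finite.

End lebesgue_cons.

(* Lebesgue measure on the Borel sets of R^n, obtained from
   R^n.+1 = R x R^n; R^0 is a point, of mass 1. *)
Fixpoint lebesgue_rV (R : realType) (n : nat) :
    {sigma_finite_measure set 'rV[R]_n -> \bar R} :=
  match n with
  | 0%N => dirac (0 : 'rV[R]_0)
  | m.+1 => lebesgue_cons (lebesgue_rV R m)
  end.

Lemma measurable_box_rV (R : realType) (n : nat)
    (A : 'I_n -> set (measurableTypeR R)) :
  (forall i, measurable (A i)) ->
  measurable [set v : 'rV[R]_n | forall i, A i (v ord0 i)].
Proof.
move=> mA.
rewrite (_ : mkset _ = \big[setI/setT]_(i < n) (@coor_rV R n i @^-1` A i)).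
  apply: bigsetI_measurable => i _; rewrite -[X in measurable X]setTI.
  exact: measurable_coor_rV.
rewrite -bigcap_seq; apply/seteqP; split=> v Av i //=.
by apply: Av => /=; rewrite mem_index_enum.
Qed.

Lemma lebesgue_rV_box (R : realType) (n : nat)
    (A : 'I_n -> set (measurableTypeR R)) :
  (forall i, measurable (A i)) ->
  lebesgue_rV R n [set v | forall i, A i (v ord0 i)] =
  (\big[*%E/1%E]_(i < n) lebesgue_measure (A i))%E.
Proof.
elim: n A => [|n IH] A mA.
  by rewrite big_ord0 /= diracE mem_set// => -[].
rewrite big_ord_recl -(IH (fun i => A (lift ord0 i))) //=.
rewrite /lebesgue_cons /pushforward -product_measure1E//; last first.
  exact: (@measurable_box_rV _ _ (fun i => A (lift ord0 i))).
congr (product_measure1 _ _ _); apply/seteqP; split=> -[x v] /=.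
  move=> Av; split; first by move: (Av ord0); rewrite coor_cons_rV0.
  by move=> i; move: (Av (lift ord0 i)); rewrite coor_cons_rVS.
move=> [Ax Av] i; case: (unliftP ord0 i) => [j ->|->].
  by rewrite coor_cons_rVS; exact: Av.
by rewrite coor_cons_rV0.
Qed.

(* R^n with the sigma-algebra of Lebesgue-measurable sets (the Caratheodory
   sigma-algebra of the outer Lebesgue measure), and the complete Lebesgue
   measure on it. *)
Definition lebesgue_space (R : realType) (n : nat) :=
  caratheodory_type ((lebesgue_rV R n)^*)%mu.
HB.instance Definition _ R n := Measurable.on (@lebesgue_space R n).

Definition complete_lebesgue (R : realType) (n : nat) :
    {measure set (lebesgue_space R n) -> \bar R} :=
  @completed_measure_extension _ _ _ (lebesgue_rV R n).

Definition first_integral (T : Type) (R : realType) (D : set T) (G : T -> T)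
    (V : T -> R) :=
  (exists x y, [/\ D x, D y & V x <> V y]) /\
  (forall x, D x -> V (G x) = V x).

Definition gradient (R : realType) (n : nat) (V : 'rV[R]_n -> R^o)
    (x : 'rV[R]_n) : 'rV[R]_n :=
  \row_i 'D_(delta_mx ord0 i) V x.

(* [U] is open in R^n, contained in [D] and dense in [D]. *)
Definition functionally_independent (R : realType) (n m : nat)
    (D : set 'rV[R]_n) (V : 'I_m -> 'rV[R]_n -> R^o) :=
  exists U : set 'rV[R]_n,
    [/\ open U, U `<=` D, D `<=` closure U &
        forall x, U x ->
          (forall i, differentiable (V i) x) /\
          row_free (\matrix_(i < m) gradient (V i) x)].

Definition invariant_set (T : Type) (G : T -> T) (A : set T) := G @` A = A.

Definition conjugation (T U : topologicalType) (A : set T) (f : T -> T)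
    (B : set U) (g : U -> U) (h : T -> U) :=
  [/\ set_bij A B h,
      {within A, continuous h},
      exists2 h' : U -> T,
        {within B, continuous h'} & (forall x, A x -> h' (h x) = x)
    & forall x, A x -> h (f x) = g (h x)].

(* [m] need only be meaningful on the measurable subsets of [D]: there it is a
   measure, and it is preserved under taking images by [G]. *)
Definition invariant_measure d (T : measurableType d) (R : realType)
    (D : set T) (G : T -> T) (m : set T -> \bar R) :=
  (exists mu : {measure set T -> \bar R},
     forall B, measurable B -> B `<=` D -> m B = mu B) /\
  (forall B, measurable B -> B `<=` D ->
     measurable (G @` B) /\ m (G @` B) = m B).

Section lyness.
Context {R : realType}.

(* 1-based: [crd x i] is x_i, meaningful for 1 <= i <= n.+1. *)
Definition crd (n : nat) (x : 'rV[R]_n.+1) (i : nat) : R := x ord0 (inord i.-1).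

Definition orthant (n : nat) : set 'rV[R]_n := [set x | forall i, 0 < x ord0 i].

(* The Lyness map in dimension k = n.+1; only its values on the open positive
   orthant are meaningful. *)
Definition lyness (a : R) (n : nat) (x : 'rV[R]_n.+1) : 'rV[R]_n.+1 :=
  \row_(i < n.+1) if (i < n)%N then crd x i.+2
                  else (a + \sum_(2 <= j < n.+2) crd x j) / crd x 1.

Definition lyness_Pi (n : nat) (x : 'rV[R]_n.+1) : R :=
  \prod_(1 <= i < n.+2) crd x i.

Definition lyness_V1 (a : R) (n : nat) (x : 'rV[R]_n.+1) : R :=
  (a + \sum_(1 <= i < n.+2) crd x i) * \prod_(1 <= i < n.+2) (crd x i + 1)
  / lyness_Pi x.

Definition lyness_V2 (a : R) (n : nat) (x : 'rV[R]_n.+1) : R :=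
  (a + \sum_(1 <= i < n.+2) crd x i + crd x 1 * crd x n.+1)
  * \prod_(1 <= i < n.+1) (1 + crd x i + crd x i.+1)
  / lyness_Pi x.

Variables (a : R) (l : nat).
Implicit Type x : 'rV[R]_(l.*2.+1).

Definition lyness_W x : R :=
  (\prod_(0 <= j < l.+1) (crd x j.*2.+1 + 1)) / \prod_(1 <= j < l.+1) crd x j.*2.

Definition lyness_V3 x : R := lyness_W x + lyness_W (lyness a x).

Definition lyness_G : set 'rV[R]_(l.*2.+1) :=
  [set x | orthant x /\ lyness_W x - lyness_W (lyness a x) = 0].

Definition lyness_Gpos : set 'rV[R]_(l.*2.+1) :=
  [set x | orthant x /\ 0 < lyness_W x - lyness_W (lyness a x)].

Definition lyness_Gneg : set 'rV[R]_(l.*2.+1) :=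
  [set x | orthant x /\ 0 < - (lyness_W x - lyness_W (lyness a x))].

(* [s] is the sign: 1 on [lyness_Gpos], -1 on [lyness_Gneg]. *)
Definition lyness_m1 (s : R) (B : set (lebesgue_space R l.*2.+1)) : \bar R :=
  (\int[complete_lebesgue R l.*2.+1]_(x in B)
     (s / (lyness_Pi (x : 'rV[R]_(l.*2.+1))
           * (lyness_W x - lyness_W (lyness a x))))%:E)%E.

Definition lyness_m2 (B : set (lebesgue_space R l.*2.+1)) : \bar R :=
  (\int[complete_lebesgue R l.*2.+1]_(x in B)
     (1 / lyness_Pi (x : 'rV[R]_(l.*2.+1)))%:E)%E.

End lyness.

Arguments lyness {R} a n x.
Arguments lyness_V1 {R} a n x.
Arguments lyness_V2 {R} a n x.
Arguments lyness_W {R} l x.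
Arguments lyness_V3 {R} a l x.
Arguments lyness_G {R} a l.
Arguments lyness_Gpos {R} a l.
Arguments lyness_Gneg {R} a l.
Arguments lyness_m1 {R} a l s B.
Arguments lyness_m2 {R} l B.

(* Main.v *)
Require Import Defs.
From HB Require Import structures.
From mathcomp Require Import all_boot all_order all_algebra.
From mathcomp Require Import all_classical all_reals all_analysis.
From mathcomp Require Import measurable_realfun ring lra zify.

Set Implicit Arguments.
Unset Strict Implicit.
Unset Printing Implicit Defensive.

Import Order.TTheory GRing.Theory Num.Theory.
Import numFieldNormedType.Exports.

Local Open Scope classical_set_scope.
Local Open Scope ring_scope.

(** Write k for the dimension 2l + 1, T for a + x_1 + ... + x_k, Pi for
    x_1 ... x_k, F for the Lyness map and x_(k+1) for the last coordinate of
    F(x).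

    The relation x_1 (x_(k+1) + 1) = T gives
      W(F(x)) = T prod (x_(2j) + 1) / prod x_(2j+1)      [lyness_W_lyness],
    whence V1 = W W(F) [lyness_V1E], and a second application of F gives
    W(F(F(x))) = W(x) [lyness_W_lyness2]. So F, which is a bijection of the
    orthant with an explicit inverse, exchanges W and W(F). The invariance of V1
    and V3 and the statements on the sets where W - W(F) is zero, positive or
    negative and on the points of odd period are formal consequences of this
    exchange. The invariance of V2 is a direct computation [lyness_V2_lyness].

    Independence. The gradients of V1 and of V3 are combinations of the
    logarithmic gradients w of W and w' of W(F), with coefficients (V1, V1) and
    (W, W(F)). So at every point where W differs from W(F) and where w, w' and
    the logarithmic gradient of V2 are independent, the three gradients are
    independent [row_free_gradients]. The second condition follows from the
    nonvanishing of the determinant delta of the derivatives along the second,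
    third and fourth coordinates. The product delta (W - W(F)) is a rational
    function which is regular on the orthant and nonzero at (1/2, 1, ..., 1),
    hence nonzero on a dense open subset of the orthant [ratl_neq0_dense].

    Measures. If (x, v) are the coordinates of R x R^(k-1), then F maps (x, v) to
    (v, S / x), where S depends on v only. Since x |-> S / x preserves the
    measure dx / x of the half-line [integral_inversion], Tonelli's theorem shows
    that F preserves dx / Pi [integral_lyness]. The function 1 / |W - W(F)| is
    invariant by F, so that the measure of density 1 / (Pi |W - W(F)|) is
    preserved as well. The passage from Borel sets to Lebesgue-measurable sets
    rests on the fact that the latter are Borel up to a null set
    [caratheodory_decomposition], and that F preserves null sets. *)

(** * The Lyness map and its inverse on the orthant *)

Lemma prod_even_odd (R : comPzRingType) (g : nat -> R) (l : nat) :
  \prod_(1 <= i < l.*2.+2) g i =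
  (\prod_(0 <= j < l.+1) g j.*2.+1) * \prod_(1 <= j < l.+1) g j.*2.
Proof.
elim: l => [|l IH]; first by rewrite !big_nat1 big_geq// mulr1.
rewrite doubleS [LHS]big_nat_recr//= [X in X * _]big_nat_recr//= IH.
rewrite [in RHS]big_nat_recr//= [X in _ = _ * X]big_nat_recr//= doubleS; ring.
Qed.

Section lyness_map.
Context {R : realType} (n : nat).
Implicit Types (x y : 'rV[R]_n.+1) (a : R).

Lemma crdE x (i : 'I_n.+1) : x ord0 i = crd x i.+1.
Proof. by rewrite /crd /= inord_val. Qed.

Lemma crd_inj x y :
  (forall i, (1 <= i < n.+2)%N -> crd x i = crd y i) -> x = y.
Proof. by move=> xy; apply/rowP => i; rewrite !crdE xy//=; exact: (ltn_ord i). Qed.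

Lemma crd_gt0 x i : orthant x -> 0 < crd x i.
Proof. by move/(_ (inord i.-1)). Qed.

Lemma crd_neq0 x i : orthant x -> crd x i != 0.
Proof. by move=> Qx; rewrite gt_eqF// crd_gt0. Qed.

Lemma orthantP x : (forall i, (1 <= i < n.+2)%N -> 0 < crd x i) -> orthant x.
Proof. by move=> x0 i; rewrite crdE x0//=; exact: (ltn_ord i). Qed.

Lemma sum_crd_ge0 x a (r : seq nat) : 0 <= a -> orthant x ->
  0 <= a + \sum_(i <- r) crd x i.
Proof.
by move=> a0 Qx; rewrite addr_ge0// sumr_ge0// => i _; rewrite ltW ?crd_gt0.
Qed.

Lemma prod_crd_gt0 x (r : seq nat) : orthant x -> 0 < \prod_(i <- r) crd x i.
Proof. by move=> Qx; rewrite prodr_gt0// => i _; exact: crd_gt0. Qed.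

Lemma lyness_Pi_gt0 x : orthant x -> 0 < lyness_Pi x.
Proof. exact: prod_crd_gt0. Qed.

Lemma crd_lyness a x i : (1 <= i < n.+1)%N -> crd (lyness a n x) i = crd x i.+1.
Proof.
case: i => [//|i] /= i_n; rewrite {1}/crd mxE /= inordK; last exact: ltnW.
by rewrite -ltnS i_n.
Qed.

Lemma crd_lyness_last a x : crd (lyness a n x) n.+1 =
  (a + \sum_(2 <= j < n.+2) crd x j) / crd x 1.
Proof. by rewrite {1}/crd mxE /= inordK// ltnn. Qed.

Lemma crd_lyness_lastK a x : orthant x ->
  crd (lyness a n x) n.+1 * crd x 1 = a + \sum_(2 <= j < n.+2) crd x j.
Proof. by move=> Qx; rewrite crd_lyness_last divfK// crd_neq0. Qed.

(** Here [crd (lyness a n x) n.+1] is x_(k+1), for k = n + 1. *)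
Lemma sum_crdE a x : orthant x ->
  a + \sum_(1 <= j < n.+2) crd x j = (crd (lyness a n x) n.+1 + 1) * crd x 1.
Proof.
by move=> Qx; rewrite big_ltn// mulrDl crd_lyness_lastK// mul1r addrCA addrC.
Qed.

(** The inverse of the Lyness map on the orthant. As for the map itself, only
    the values at points of the orthant are meaningful. *)
Definition lyness_inv a y : 'rV[R]_n.+1 :=
  \row_(i < n.+1) if i == 0%N :> nat
                  then (a + \sum_(1 <= j < n.+1) crd y j) / crd y n.+1
                  else crd y i.

Lemma crd_lyness_inv1 a y : crd (lyness_inv a y) 1 =
  (a + \sum_(1 <= j < n.+1) crd y j) / crd y n.+1.
Proof. by rewrite {1}/crd mxE /= inordK. Qed.

Lemma crd_lyness_inv a y i : (1 <= i < n.+1)%N ->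
  crd (lyness_inv a y) i.+1 = crd y i.
Proof. by case: i => [//|i] i_n; rewrite {1}/crd mxE /= inordK. Qed.

Lemma sum_crd_lyness a x :
  \sum_(1 <= j < n.+1) crd (lyness a n x) j = \sum_(2 <= j < n.+2) crd x j.
Proof.
by rewrite [RHS]big_add1; apply: eq_big_nat => i; exact: crd_lyness.
Qed.

Lemma sum_crd_lyness_inv a y :
  \sum_(2 <= j < n.+2) crd (lyness_inv a y) j = \sum_(1 <= j < n.+1) crd y j.
Proof. by rewrite big_add1; apply: eq_big_nat => i; exact: crd_lyness_inv. Qed.

End lyness_map.

Section lyness_pos.
Context {R : realType} (n : nat).
Hypothesis n_gt0 : (0 < n)%N.
Variable a : R.
Hypothesis a_ge0 : 0 <= a.
Implicit Types x y : 'rV[R]_n.+1.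

Let sum1_gt0 x : orthant x -> 0 < a + \sum_(1 <= j < n.+1) crd x j.
Proof.
move=> Qx; rewrite big_ltn// addrCA ltr_wpDr ?crd_gt0//.
exact: sum_crd_ge0.
Qed.

Let sum2_gt0 x : orthant x -> 0 < a + \sum_(2 <= j < n.+2) crd x j.
Proof.
move=> Qx; rewrite big_nat_recr//= addrA ltr_wpDl ?crd_gt0//.
exact: sum_crd_ge0.
Qed.

Lemma lyness_orthant x : orthant x -> orthant (lyness a n x).
Proof.
move=> Qx; apply: orthantP => i /andP[i1]; rewrite ltnS leq_eqVlt.
move=> /predU1P[->|i_n]; last by rewrite crd_lyness ?crd_gt0// i1.
by rewrite crd_lyness_last divr_gt0 ?crd_gt0// sum2_gt0.
Qed.

Lemma lyness_inv_orthant y : orthant y -> orthant (lyness_inv a y).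
Proof.
move=> Qy; apply: orthantP => -[//|[|i]] i_n.
  by rewrite crd_lyness_inv1 divr_gt0 ?crd_gt0// sum1_gt0.
by rewrite crd_lyness_inv ?crd_gt0.
Qed.

Lemma lynessK x : orthant x -> lyness_inv a (lyness a n x) = x.
Proof.
move=> Qx; apply: crd_inj => -[//|[|i]] i_n.
  rewrite crd_lyness_inv1 sum_crd_lyness crd_lyness_last invf_div mulrCA.
  by rewrite divff ?mulr1// gt_eqF// sum2_gt0.
by rewrite crd_lyness_inv// crd_lyness.
Qed.

Lemma lyness_invK y : orthant y -> lyness a n (lyness_inv a y) = y.
Proof.
move=> Qy; apply: crd_inj => i /andP[i1]; rewrite ltnS leq_eqVlt.
move=> /predU1P[->|i_n]; last by rewrite crd_lyness ?i1// crd_lyness_inv// i1.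
rewrite crd_lyness_last sum_crd_lyness_inv crd_lyness_inv1 invf_div mulrCA.
by rewrite divff ?mulr1// gt_eqF// sum1_gt0.
Qed.

End lyness_pos.

(** * The functions W, V1, V2 and V3 along the Lyness map *)

Section lyness_W.
Context {R : realType} (l : nat) (a : R).
Implicit Types x : 'rV[R]_(l.*2.+1).
Local Notation F := (lyness a l.*2).

Lemma lyness_W_lyness x : orthant x ->
  lyness_W l (F x) =
  (a + \sum_(1 <= i < l.*2.+2) crd x i) * (\prod_(1 <= j < l.+1) (crd x j.*2 + 1))
  / \prod_(0 <= j < l.+1) crd x j.*2.+1.
Proof.
move=> Qx; rewrite /lyness_W big_nat_recr//=.
have -> : \prod_(0 <= j < l) (crd (F x) j.*2.+1 + 1) =
          \prod_(1 <= j < l.+1) (crd x j.*2 + 1).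
  by rewrite [RHS]big_add1/=; apply: eq_big_nat => j j_l; rewrite crd_lyness//; lia.
have -> : \prod_(1 <= j < l.+1) crd (F x) j.*2 = \prod_(1 <= j < l.+1) crd x j.*2.+1.
  by apply: eq_big_nat => j j_l; rewrite crd_lyness//; lia.
rewrite sum_crdE// [X in _ = _ / X]big_ltn//=.
have := crd_neq0 1 Qx; have : \prod_(1 <= j < l.+1) crd x j.*2.+1 != 0.
  by rewrite gt_eqF// prodr_gt0// => *; exact: crd_gt0.
by move=> ? ?; field; apply/andP.
Qed.

Lemma lyness_W_gt0 x : orthant x -> 0 < lyness_W l x.
Proof.
move=> Qx; rewrite divr_gt0// prodr_gt0// => i _; rewrite ?crd_gt0//.
by rewrite addr_gt0// crd_gt0.
Qed.

Lemma lyness_V1E x : orthant x ->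
  lyness_V1 a l.*2 x = lyness_W l x * lyness_W l (F x).
Proof.
move=> Qx; rewrite lyness_W_lyness// /lyness_V1 /lyness_W /lyness_Pi.
rewrite (prod_even_odd (fun i => crd x i + 1)) (prod_even_odd (crd x)).
have : \prod_(1 <= j < l.+1) crd x j.*2 != 0.
  by rewrite gt_eqF// prodr_gt0// => *; exact: crd_gt0.
have : \prod_(0 <= j < l.+1) crd x j.*2.+1 != 0.
  by rewrite gt_eqF// prodr_gt0// => *; exact: crd_gt0.
by move=> ? ?; field; apply/andP.
Qed.

Lemma lyness_V3E x : orthant x -> lyness_V3 a l x =
  (\prod_(0 <= j < l.+1) (crd x j.*2.+1 * (crd x j.*2.+1 + 1))
   + (a + \sum_(1 <= j < l.*2.+2) crd x j)
     * \prod_(1 <= j < l.+1) (crd x j.*2 * (crd x j.*2 + 1)))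
  / \prod_(1 <= i < l.*2.+2) crd x i.
Proof.
move=> Qx; rewrite /lyness_V3 lyness_W_lyness// /lyness_W.
rewrite (prod_even_odd (crd x)) !big_split/=.
have : \prod_(1 <= j < l.+1) crd x j.*2 != 0.
  by rewrite gt_eqF// prodr_gt0// => *; exact: crd_gt0.
have : \prod_(0 <= j < l.+1) crd x j.*2.+1 != 0.
  by rewrite gt_eqF// prodr_gt0// => *; exact: crd_gt0.
by move=> ? ?; field; apply/andP.
Qed.

Hypothesis l_gt0 : (0 < l)%N.
Hypothesis a_ge0 : 0 <= a.

Let n_gt0 : (0 < l.*2)%N. Proof. by rewrite double_gt0. Qed.

Lemma lyness_W_lyness2 x : orthant x -> lyness_W l (F (F x)) = lyness_W l x.
Proof.
move=> Qx; have QFx := lyness_orthant n_gt0 a_ge0 Qx.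
rewrite lyness_W_lyness// big_nat_recr//= addrA sum_crd_lyness.
rewrite -crd_lyness_lastK// /lyness_W [in RHS]big_ltn//.
rewrite [X in _ / X]big_nat_recr//=.
have -> : \prod_(1 <= j < l.+1) (crd (F x) j.*2 + 1) =
          \prod_(1 <= j < l.+1) (crd x j.*2.+1 + 1).
  by apply: eq_big_nat => j j_l; rewrite crd_lyness//; lia.
have -> : \prod_(0 <= j < l) crd (F x) j.*2.+1 =
          \prod_(1 <= j < l.+1) crd x j.*2.
  by rewrite [RHS]big_add1/=; apply: eq_big_nat => j j_l; rewrite crd_lyness//; lia.
have := crd_neq0 l.*2.+1 QFx; have : \prod_(1 <= j < l.+1) crd x j.*2 != 0.
  by rewrite gt_eqF// prodr_gt0// => *; exact: crd_gt0.
by move=> ? ?; rewrite double0; field; apply/andP.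
Qed.

End lyness_W.

Lemma lyness_V2_lyness (R : realType) (n : nat) (a : R) (x : 'rV[R]_n.+1) :
  (0 < n)%N -> 0 <= a -> orthant x ->
  lyness_V2 a n (lyness a n x) = lyness_V2 a n x.
Proof.
move=> n0 a0 Qx; have QFx := lyness_orthant n0 a0 Qx.
rewrite /lyness_V2 /lyness_Pi.
set F := lyness a n.
rewrite [\sum_(1 <= i < n.+2) crd (F x) i]big_nat_recr//= addrA sum_crd_lyness.
rewrite -(crd_lyness_lastK a)// sum_crdE//.
rewrite [\prod_(1 <= i < n.+2) crd (F x) i]big_nat_recr//=.
rewrite (@big_ltn _ _ _ 1 n.+2)//=.
have -> : \prod_(1 <= i < n.+1) crd (F x) i = \prod_(2 <= i < n.+2) crd x i.
  rewrite [RHS]big_add1.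
  by apply: eq_big_nat => i; exact: crd_lyness.
rewrite (@big_ltn _ _ _ 1 n.+1 (fun i => 1 + crd x i + crd x i.+1))//.
have -> : \prod_(1 <= i < n.+1) (1 + crd (F x) i + crd (F x) i.+1) =
   (\prod_(2 <= i < n.+1) (1 + crd x i + crd x i.+1))
   * (1 + crd x n.+1 + crd (F x) n.+1).
  case: n n0 x Qx {QFx} @F => // n _ x Qx F.
  rewrite big_nat_recr//=; congr (_ * _).
    rewrite [RHS]big_add1; apply: eq_big_nat => i i_n.
    by rewrite !crd_lyness//; lia.
  by rewrite (@crd_lyness _ _ _ _ n.+1)//= ltnSn.
rewrite (@crd_lyness _ _ a x 1)//.
have := crd_neq0 n.+1 QFx; have := crd_neq0 1 Qx.
have := lt0r_neq0 (prod_crd_gt0 (index_iota 2 n.+2) Qx).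
have Hl : crd (F x) n.+1 * crd x 1 = crd (F x) n.+1 * crd x 1 by [].
move=> ? ? ?; field; do ?[apply/andP; split=> //].
Qed.

(** * First integrals and the level W = W(F) *)

Section lyness_first_integrals.
Context {R : realType} (n : nat).

(** The point (u, 1, ..., 1), at which the first integrals are easy to evaluate. *)
Definition axis_pt (u : R) : 'rV[R]_n.+1 := \row_i if i == ord0 then u else 1.

Lemma crd_pt1 u : crd (axis_pt u) 1 = u.
Proof. by rewrite /crd mxE -val_eqE /= inordK. Qed.

Lemma crd_pt u i : (1 < i < n.+2)%N -> crd (axis_pt u) i = 1.
Proof. by case: i => [//|[//|i]] i_n; rewrite /crd mxE -val_eqE /= inordK. Qed.

Lemma orthant_pt u : 0 < u -> orthant (axis_pt u).
Proof. by move=> u0 i; rewrite mxE; case: ifP. Qed.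

Lemma sum_pt u : \sum_(1 <= j < n.+2) crd (axis_pt u) j = u + n%:R.
Proof.
rewrite big_ltn// crd_pt1; congr (_ + _).
rewrite (eq_big_nat _ _ (F2 := fun=> 1 : R)) ?sumr_const_nat ?subSS ?subn0// => i.
exact: crd_pt.
Qed.

Lemma lyness_Pi_pt u : lyness_Pi (axis_pt u) = u.
Proof.
rewrite /lyness_Pi big_ltn// crd_pt1.
rewrite (eq_big_nat _ _ (F2 := fun=> 1 : R)) ?big1_eq ?mulr1// => i.
exact: crd_pt.
Qed.

Lemma lyness_V1_pt a u :
  lyness_V1 a n (axis_pt u) = (a + (u + n%:R)) * ((u + 1) * 2 ^+ n) / u.
Proof.
rewrite /lyness_V1 sum_pt lyness_Pi_pt big_ltn// crd_pt1.
rewrite (eq_big_nat _ _ (F2 := fun=> 2 : R)) ?prodr_const_nat ?subSS ?subn0// => i i_n.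
by rewrite crd_pt.
Qed.

End lyness_first_integrals.

Arguments axis_pt {R n} u.

Lemma lyness_V2_pt (R : realType) (n : nat) (a u : R) :
  lyness_V2 a n.+1 (axis_pt u) =
  (a + (u + n.+1%:R) + u) * ((2 + u) * 3 ^+ n) / u.
Proof.
rewrite /lyness_V2 sum_pt lyness_Pi_pt crd_pt1 crd_pt ?ltnSn// mulr1.
rewrite big_ltn// crd_pt1 (@crd_pt _ _ _ 2)//.
have -> : \prod_(2 <= i < n.+2)
    (1 + crd (@axis_pt R n.+1 u) i + crd (@axis_pt R n.+1 u) i.+1) = 3 ^+ n.
  transitivity (\prod_(2 <= i < n.+2) (3 : R)); last first.
    by rewrite prodr_const_nat !subSS subn0.
  apply: eq_big_nat => i /andP[i1 i_n].
  have -> : crd (@axis_pt R n.+1 u) i = 1 by rewrite crd_pt// i1 ltnW.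
  have -> : crd (@axis_pt R n.+1 u) i.+1 = 1 by rewrite crd_pt// ltnS (ltnW i1).
  lra.
by congr (_ * (_ * _) / _); lra.
Qed.

Lemma lyness_W_pt (R : realType) (l : nat) (u : R) :
  lyness_W l (axis_pt u) = (u + 1) * 2 ^+ l.
Proof.
rewrite /lyness_W [X in _ / X](eq_big_nat _ _ (F2 := fun=> 1 : R)); last first.
  by move=> i i_n; rewrite crd_pt//; lia.
rewrite big1_eq divr1 big_ltn//= crd_pt1; congr (_ * _).
rewrite (eq_big_nat _ _ (F2 := fun=> 2 : R)) ?prodr_const_nat ?subSS ?subn0// => i i_n.
by rewrite crd_pt//; lia.
Qed.

Section lyness_odd.
Context {R : realType} (l : nat) (a : R).
Hypothesis l_gt0 : (0 < l)%N.
Hypothesis a_ge0 : 0 <= a.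
Implicit Types x : 'rV[R]_(l.*2.+1).
Local Notation F := (lyness a l.*2).
Local Notation W := (lyness_W l).
Local Notation Q := (@orthant R l.*2.+1).

Let n_gt0 : (0 < l.*2)%N. Proof. by rewrite double_gt0. Qed.

Let QF x : orthant x -> orthant (F x).
Proof. exact: lyness_orthant. Qed.

Let QFi x : orthant x -> orthant (lyness_inv a x).
Proof. exact: lyness_inv_orthant. Qed.

Let W2 x : orthant x -> W (F (F x)) = W x.
Proof. exact: lyness_W_lyness2. Qed.

Lemma lyness_W_lyness_pt (u : R) : 0 < u ->
  W (F (axis_pt u)) = (a + (u + l.*2%:R)) * 2 ^+ l / u.
Proof.
move=> u0; have u1 : u + 1 != 0 by rewrite gt_eqF// addr_gt0.
have Qu := orthant_pt (n := l.*2) u0.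
have W0 : W (axis_pt u) != 0 by rewrite gt_eqF// lyness_W_gt0.
apply: (mulfI W0); rewrite -lyness_V1E// lyness_V1_pt lyness_W_pt.
rewrite -addnn exprD; have u2 : u != 0 by rewrite gt_eqF.
by field.
Qed.

Lemma first_integral_W : first_integral Q (F \o F) W.
Proof.
split; last by move=> x Qx; exact: W2.
exists (axis_pt 1), (axis_pt 2); split; try exact: orthant_pt.
rewrite !lyness_W_pt => e; have l0 : (2 : R) ^+ l != 0 by rewrite expf_neq0.
by have := mulIf l0 e; lra.
Qed.

Lemma first_integral_V1 : (1 < l)%N -> first_integral Q F (lyness_V1 a l.*2).
Proof.
move=> l1; split; last first.
  by move=> x Qx; rewrite !lyness_V1E ?W2 1?mulrC//; exact: QF.
exists (axis_pt 1), (axis_pt 2); split; try exact: orthant_pt.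
(* equality of the two values would mean a + 2l = 2 *)
have l4 : (4 : R) <= l.*2%:R by rewrite ler_nat; lia.
rewrite !lyness_V1_pt. move: (l.*2%:R : R) l4 => N l4 e.
have l0 : (2 : R) ^+ l.*2 != 0 by rewrite expf_neq0.
have e2 := congr1 ( *%R^~ 2) e; rewrite /= divfK// in e2.
suff e3 : (a + (1 + N)) * (1 + 1) * 2 = (a + (2 + N)) * (2 + 1) :> R.
  by have := a_ge0; lra.
by apply: (mulIf l0); rewrite -[RHS]mulrA -e2; field.
Qed.

Lemma first_integral_V2 : (1 < l)%N -> first_integral Q F (lyness_V2 a l.*2).
Proof.
move=> l1; split; last first.
  by move=> x Qx; exact: lyness_V2_lyness.
exists (axis_pt 1), (axis_pt 2); split; try exact: orthant_pt.
have [n ->] : exists n, l.*2 = n.+4 by exists (l.*2 - 4)%N; lia.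
have l4 : (4 : R) <= n.+4%:R by rewrite ler_nat.
rewrite !lyness_V2_pt. move: (n.+4%:R : R) l4 => N l4 e.
have l0 : (3 : R) ^+ n.+3 != 0 by rewrite expf_neq0.
have e2 := congr1 ( *%R^~ 2) e; rewrite /= divfK// in e2.
suff e3 : (a + (1 + N) + 1) * (2 + 1) * 2 = (a + (2 + N) + 2) * (2 + 2) :> R.
  by have := a_ge0; lra.
by apply: (mulIf l0); rewrite -[RHS]mulrA -e2; field.
Qed.

Lemma first_integral_V3 : (1 < l)%N -> first_integral Q F (lyness_V3 a l).
Proof.
move=> l1; split; last first.
  by move=> x Qx; rewrite /lyness_V3 W2// addrC.
exists (axis_pt 1), (axis_pt 2); split; try exact: orthant_pt.
have l4 : (4 : R) <= l.*2%:R by rewrite ler_nat; lia.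
rewrite /lyness_V3 !lyness_W_lyness_pt// !lyness_W_pt.
move: (l.*2%:R : R) l4 => N l4 e.
have l0 : (2 : R) ^+ l != 0 by rewrite expf_neq0.
have e2 := congr1 ( *%R^~ 2) e; rewrite /= [in RHS]mulrDl divfK// in e2.
suff e3 : (1 + 1 + (a + (1 + N))) * 2 = (2 + 1) * 2 + (a + (2 + N)) :> R.
  by have := a_ge0; lra.
by apply: (mulIf l0); rewrite [RHS]mulrDl [X in _ = X + _]mulrAC -e2; field.
Qed.

(** The image by F of a subset A of the orthant is B, as soon as F(x) is in B
    exactly when x is in A. *)
Lemma image_lyness (A B : set 'rV[R]_(l.*2.+1)) :
  A `<=` Q -> B `<=` Q ->
  (forall x, A x -> B (F x)) -> (forall x, orthant x -> B (F x) -> A x) ->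
  F @` A = B.
Proof.
move=> AQ BQ AB BA; apply/seteqP; split=> [_ [x Ax <-]|y By]; first exact: AB.
have Qy := BQ _ By; exists (lyness_inv a y); last by rewrite lyness_invK.
by apply: BA; [exact: QFi|rewrite lyness_invK].
Qed.

Lemma invariant_lyness_G : invariant_set F (lyness_G a l).
Proof.
apply: image_lyness => [x []//|x []//|x [Qx e]|x Qx [_]].
  by split; [exact: QF|rewrite W2// -opprB e oppr0].
by rewrite W2// => e; split=> //; rewrite -opprB e oppr0.
Qed.

Lemma image_lyness_Gpos : F @` lyness_Gpos a l = lyness_Gneg a l.
Proof.
apply: image_lyness => [x []//|x []//|x [Qx e]|x Qx [_]].
  by split; [exact: QF|rewrite W2// opprB].
by rewrite W2// opprB.
Qed.

Lemma image_lyness_Gneg : F @` lyness_Gneg a l = lyness_Gpos a l.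
Proof.
apply: image_lyness => [x []//|x []//|x [Qx e]|x Qx [_]].
  by split; [exact: QF|rewrite W2// -opprB].
by rewrite W2// => e; split=> //; rewrite opprB.
Qed.

Lemma odd_period_lyness_G (p : nat) x :
  odd p -> orthant x -> iter p F x = x -> lyness_G a l x.
Proof.
move=> p_odd Qx Fpx; split=> //.
have Qq q : orthant (iter q F x) by elim: q => // q IH; exact: QF.
have Wq q : W (iter q F x) = (if odd q then W (F x) else W x) /\
    W (iter q.+1 F x) = if odd q then W x else W (F x).
  elim: q => // q [IH IH']; rewrite [iter q.+2 _ _]/= W2//.
  by rewrite IH IH' /=; case: odd.
by have [] := Wq p; rewrite Fpx p_odd => <-; rewrite subrr.
Qed.

End lyness_odd.

(** * Continuity of the Lyness map and of its inverse *)

Lemma continuous_rV (R : realType) (T : topologicalType) (n : nat)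
    (f : T -> 'rV[R]_n) (x : T) :
  (forall j, (fun y => f y ord0 j) @ x --> f x ord0 j) -> f @ x --> f x.
Proof.
move=> cf; move=> A [P Pf PA].
have fP : \forall y \near x, forall ij : 'I_1 * 'I_n, P ij.1 ij.2 (f y ij.1 ij.2).
  apply: filter_forall => -[i j] /=; rewrite (ord1 i); apply: (cf j).
  by have := Pf ord0 j.
by apply: filterS fP => y Py; apply: PA => i j; exact: (Py (i, j)).
Qed.

Section continuous_lyness.
Context {R : realType} (n : nat) (a : R).
Implicit Types x : 'rV[R]_n.+1.

Lemma continuous_crd i : continuous (fun x => crd x i).
Proof. exact: coord_continuous. Qed.

Lemma continuous_sum_crd (r : seq nat) :
  continuous (fun x => a + \sum_(i <- r) crd x i).
Proof.
suff sc : continuous (fun x => \sum_(i <- r) crd x i).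
  by move=> x; exact: (continuousD (@cst_continuous _ _ a x) (sc x)).
elim: r => [|i r IH].
  have -> : (fun x => \sum_(i <- [::]) crd x i) = cst 0.
    by apply/funext => y; rewrite big_nil.
  exact: cst_continuous.
have -> : (fun x => \sum_(j <- i :: r) crd x j) =
          (fun y => crd y i + \sum_(j <- r) crd y j).
  by apply/funext => y; rewrite big_cons.
by move=> x; exact: (continuousD (@continuous_crd i x) (IH x)).
Qed.

Let continuous_sum_div i (r : seq nat) x : orthant x ->
  {for x, continuous (fun x => (a + \sum_(i <- r) crd x i) / crd x i)}.
Proof.
move=> Qx; apply: (continuousM (@continuous_sum_crd r x)).
by apply: continuousV; [exact: crd_neq0|exact: continuous_crd].
Qed.

Lemma continuous_lyness x : orthant x -> {for x, continuous (lyness a n)}.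
Proof.
move=> Qx; apply: continuous_rV => j; have [jn|jn] := boolP (j < n)%N.
  have E y : lyness a n y ord0 j = crd y j.+2 by rewrite mxE jn.
  by rewrite E; under eq_fun do rewrite E; exact: continuous_crd.
have E y : lyness a n y ord0 j = (a + \sum_(2 <= j < n.+2) crd y j) / crd y 1.
  by rewrite mxE (negbTE jn).
by rewrite E; under eq_fun do rewrite E; exact: continuous_sum_div.
Qed.

Lemma continuous_lyness_inv x :
  orthant x -> {for x, continuous (@lyness_inv R n a)}.
Proof.
move=> Qx; apply: continuous_rV => j; have [j0|j0] := boolP (j == 0%N :> nat).
  have E y : lyness_inv a y ord0 j =
      (a + \sum_(1 <= j < n.+1) crd y j) / crd y n.+1 by rewrite mxE j0.
  by rewrite E; under eq_fun do rewrite E; exact: continuous_sum_div.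
have E y : lyness_inv a y ord0 j = crd y j by rewrite mxE (negbTE j0).
by rewrite E; under eq_fun do rewrite E; exact: continuous_crd.
Qed.

End continuous_lyness.

Lemma conjugation_lyness (R : realType) (l : nat) (a : R) :
  (0 < l)%N -> 0 <= a ->
  let F := lyness a l.*2 in
  conjugation (lyness_Gpos a l) (F \o F) (lyness_Gneg a l) (F \o F) F.
Proof.
move=> l_gt0 a_ge0 F; have n_gt0 : (0 < l.*2)%N by rewrite double_gt0.
split=> //.
- split.
  + by rewrite -image_lyness_Gpos//; exact: image_subP.
  + move=> x y /set_mem[Qx _] /set_mem[Qy _] /(congr1 (lyness_inv a)).
    by rewrite !lynessK.
  + by rewrite -image_lyness_Gpos//; move=> y.
- apply: continuous_in_subspaceT => x /set_mem[Qx _].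
  exact: continuous_lyness.
- exists (lyness_inv a) => [|x [Qx _]]; last exact: lynessK.
  apply: continuous_in_subspaceT => x /set_mem[Qx _].
  exact: continuous_lyness_inv.
Qed.

(** * Logarithmic derivatives *)

Section dlog.
Context {R : realType} {V : normedModType R}.
Implicit Types (f g : V -> R) (x v : V) (c d : R).

(** [hasD f x v c]: f is differentiable at x, with derivative c along v. *)
Definition hasD f x v c := differentiable f x /\ 'd f x v = c.

(** [dlog f x v d]: f is differentiable at x, with logarithmic derivative d
    along v; the derivative is written f(x) d, so that no division occurs. *)
Definition dlog f x v d := hasD f x v (f x * d).

Lemma hasD_cst c x v : hasD (fun=> c) x v 0.
Proof. by split; [exact: differentiable_cst|rewrite diff_cst]. Qed.

Lemma hasDD f g x v c d : hasD f x v c -> hasD g x v d ->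
  hasD (fun y => f y + g y) x v (c + d).
Proof.
move=> [df <-] [dg <-]; split; first exact: differentiableD.
by have -> := diffD df dg.
Qed.

Lemma hasDM f g x v c d : hasD f x v c -> hasD g x v d ->
  hasD (fun y => f y * g y) x v (f x * d + g x * c).
Proof.
move=> [df <-] [dg <-]; split; first exact: differentiableM.
by have -> := diffM df dg.
Qed.

Lemma hasD_sum (r : seq nat) (f : nat -> V -> R) (c : nat -> R) x v :
  (forall i, i \in r -> hasD (f i) x v (c i)) ->
  hasD (fun y => \sum_(i <- r) f i y) x v (\sum_(i <- r) c i).
Proof.
elim: r => [|i r IH] H.
  rewrite big_nil (_ : (fun y => _) = fun=> 0); first exact: hasD_cst.
  by apply/funext => y; rewrite big_nil.
rewrite big_cons (_ : (fun y => _) = fun y => f i y + \sum_(j <- r) f j y).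
  apply: hasDD; first by apply: H; rewrite mem_head.
  by apply: IH => j jr; apply: H; rewrite inE jr orbT.
by apply/funext => y; rewrite big_cons.
Qed.

Lemma dlogP f x v c : f x != 0 -> hasD f x v c -> dlog f x v (c / f x).
Proof. by move=> fx0; rewrite /dlog mulrC divfK. Qed.

Lemma dlogM f g x v c d : dlog f x v c -> dlog g x v d ->
  dlog (fun y => f y * g y) x v (c + d).
Proof.
move=> df dg; have := hasDM df dg; rewrite /dlog.
by rewrite (_ : _ + _ = f x * g x * (c + d)) //; ring.
Qed.

Lemma dlogV f x v d : f x != 0 -> dlog f x v d ->
  dlog (fun y => (f y)^-1) x v (- d).
Proof.
move=> fx0 [df dfE]; split; first exact: differentiableV.
have -> := diffV df fx0; rewrite /= dfE.
by rewrite [LHS]/GRing.scale/=; field.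
Qed.

Lemma dlog_div f g x v c d : g x != 0 -> dlog f x v c -> dlog g x v d ->
  dlog (fun y => f y / g y) x v (c - d).
Proof. by move=> gx0 df dg; apply: dlogM df _; exact: dlogV. Qed.

Lemma dlog_prod (r : seq nat) (f : nat -> V -> R) (c : nat -> R) x v :
  (forall i, i \in r -> dlog (f i) x v (c i)) ->
  dlog (fun y => \prod_(i <- r) f i y) x v (\sum_(i <- r) c i).
Proof.
elim: r => [|i r IH] H.
  rewrite big_nil (_ : (fun y => _) = fun=> 1).
    by rewrite /dlog mulr0; exact: hasD_cst.
  by apply/funext => y; rewrite big_nil.
rewrite big_cons (_ : (fun y => _) = fun y => f i y * \prod_(j <- r) f j y).
  apply: dlogM; first by apply: H; rewrite mem_head.
  by apply: IH => j jr; apply: H; rewrite inE jr orbT.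
by apply/funext => y; rewrite big_cons.
Qed.

End dlog.

Section delta_sums.
Context {R : pzSemiRingType}.
Implicit Types (g : nat -> R) (i m p : nat).

Lemma sum_delta g i m p : (m <= i < p)%N ->
  \sum_(m <= j < p) (j == i)%:R * g j = g i.
Proof.
move=> /andP[mi ip]; rewrite (bigD1_seq i) ?mem_index_iota ?mi ?iota_uniq//=.
by rewrite eqxx mul1r big1 ?addr0// => j /negbTE ->; rewrite mul0r.
Qed.

Lemma sum_delta0 g i m p : ~~ (m <= i < p)%N ->
  \sum_(m <= j < p) (j == i)%:R * g j = 0.
Proof.
move=> ip; rewrite big_nat big1// => j jp; have [ji|] := eqVneq; last by rewrite mul0r.
by rewrite -ji jp in ip.
Qed.

End delta_sums.

(** * Gradients of the first integrals *)

Section lyness_gradients.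
Context {R : realType} (n : nat).
Implicit Types x : 'rV[R]_n.+1.

(** The i-th vector of the canonical basis, numbered from 1 as in [crd]. *)
Definition bvec i : 'rV[R]_n.+1 := delta_mx ord0 (inord i.-1).

Lemma hasD_crd i j x : (1 <= i < n.+2)%N -> (1 <= j < n.+2)%N ->
  hasD (fun y => crd y j) x (bvec i) (j == i)%:R.
Proof.
move=> /andP[i1 i_n] /andP[j1 j_n]; split; first exact: differentiable_coord.
pose f := (fun y : 'rV[R]_n.+1 => y ord0 (inord j.-1)) : _ -> R^o.
have lf : linear f by move=> c y z; rewrite /f !mxE.
pose fM := GRing.isLinear.Build _ _ _ _ f lf.
pose fL : {linear 'rV[R]_n.+1 -> R^o} := HB.pack f fM.
have -> : (fun y => crd y j) = fL :> (_ -> R^o) by [].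
rewrite diff_lin; last exact: coord_continuous.
rewrite /fL/= /f /bvec mxE eqxx/= -val_eqE/= !inordK ?prednK//.
by rewrite -(eqn_add2r 1) !addn1 !prednK.
Qed.

Lemma hasD_sum_crd (a : R) i x m : (m.+1 <= i < n.+2)%N ->
  hasD (fun y => a + \sum_(m.+1 <= j < n.+2) crd y j) x (bvec i) 1.
Proof.
move=> i_n; rewrite -[1]add0r; apply: hasDD; first exact: hasD_cst.
rewrite -(sum_delta (fun=> 1) i_n).
apply: hasD_sum => j; rewrite mem_index_iota => jn.
by rewrite mulr1; apply: hasD_crd; lia.
Qed.

Lemma dlog_crd i j x : crd x j != 0 -> (1 <= i < n.+2)%N -> (1 <= j < n.+2)%N ->
  dlog (fun y => crd y j) x (bvec i) ((j == i)%:R * (crd x j)^-1).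
Proof. by move=> xj0 i_n j_n; apply: dlogP => //; exact: hasD_crd. Qed.

Lemma dlog_crdD1 i j x : orthant x ->
  (1 <= i < n.+2)%N -> (1 <= j < n.+2)%N ->
  dlog (fun y => crd y j + 1) x (bvec i) ((j == i)%:R * (crd x j + 1)^-1).
Proof.
move=> Qx i_n j_n.
apply: (@dlogP _ _ (fun y => crd y j + 1)).
  by rewrite gt_eqF// addr_gt0// crd_gt0.
by rewrite -[_%:R]addr0; apply: hasDD; [exact: hasD_crd|exact: hasD_cst].
Qed.

Lemma dlog_Pi i x : orthant x -> (1 <= i < n.+2)%N ->
  dlog (@lyness_Pi R n) x (bvec i) (crd x i)^-1.
Proof.
move=> Qx i_n; rewrite -(sum_delta (fun j => (crd x j)^-1) i_n).
apply: dlog_prod => j; rewrite mem_index_iota => jn.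
by apply: dlog_crd => //; exact: crd_neq0.
Qed.

Variable a : R.
Hypothesis a_ge0 : 0 <= a.

Let T x := a + \sum_(1 <= j < n.+2) crd x j.

Let T_gt0 x : orthant x -> 0 < T x.
Proof.
move=> Qx; rewrite /T big_ltn// addrCA ltr_wpDr ?crd_gt0//.
exact: sum_crd_ge0.
Qed.

Lemma dlog_V1 i x : orthant x -> (1 <= i < n.+2)%N ->
  dlog (lyness_V1 a n) x (bvec i) ((T x)^-1 + (crd x i + 1)^-1 - (crd x i)^-1).
Proof.
move=> Qx i_n; apply: dlog_div (dlog_Pi Qx i_n).
  by rewrite gt_eqF// lyness_Pi_gt0.
apply: dlogM.
  rewrite -[_^-1]mul1r; apply: dlogP; first by rewrite gt_eqF// T_gt0.
  exact: hasD_sum_crd.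
rewrite -(sum_delta (fun j => (crd x j + 1)^-1) i_n).
apply: dlog_prod => j; rewrite mem_index_iota => jn.
exact: dlog_crdD1.
Qed.

Lemma dlog_V2 i x : orthant x -> (1 < i < n.+1)%N ->
  dlog (lyness_V2 a n) x (bvec i)
  ((T x + crd x 1 * crd x n.+1)^-1
   + ((1 + crd x i + crd x i.+1)^-1 + (1 + crd x i.-1 + crd x i)^-1)
   - (crd x i)^-1).
Proof.
move=> Qx i_n; have i0 : (1 <= i < n.+2)%N by lia.
apply: dlog_div (dlog_Pi Qx i0).
  by rewrite gt_eqF// lyness_Pi_gt0.
apply: dlogM.
  rewrite -[_^-1]mul1r.
  apply: (@dlogP _ _ (fun y => T y + crd y 1 * crd y n.+1)).
    by rewrite gt_eqF// addr_gt0// ?T_gt0// mulr_gt0// crd_gt0.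
  rewrite -[X in hasD _ _ _ X]addr0; apply: hasDD; first by apply: hasD_sum_crd; lia.
  have i1 : (1 <= i < n.+2)%N by lia.
  have := hasDM (@hasD_crd i 1 x i1 isT) (@hasD_crd i n.+1 x i1 (leqnn _)).
  rewrite [1%N == i]ltn_eqF; last lia.
  by rewrite [n.+1 == i]gtn_eqF ?mulr0 ?addr0//; lia.
have i1 : (1 <= i < n.+1)%N by lia.
have i2 : (1 <= i.-1 < n.+1)%N by lia.
rewrite -(sum_delta (fun j => (1 + crd x j + crd x j.+1)^-1) i1).
have := sum_delta (fun j => (1 + crd x j + crd x j.+1)^-1) i2.
rewrite (@prednK i); last lia.
move=> <-; rewrite -big_split/=.
apply: dlog_prod => j; rewrite mem_index_iota => jn.
rewrite -mulrDl; apply: (@dlogP _ _ (fun y => 1 + crd y j + crd y j.+1)).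
  by rewrite gt_eqF// !addr_gt0// crd_gt0.
apply: hasDD.
  by rewrite -[_%:R]add0r; apply: hasDD; [exact: hasD_cst|apply: hasD_crd; lia].
rewrite (_ : (j == i.-1) = (j.+1 == i)); last by apply/eqP/eqP; lia.
by apply: hasD_crd; lia.
Qed.

End lyness_gradients.

(** The logarithmic derivatives of W and of W o F along the even and the odd
    coordinates. *)

Section lyness_W_log_derivatives.
Context {R : realType} (l : nat).
Implicit Types x : 'rV[R]_(l.*2.+1).
Local Notation W := (lyness_W l).

Lemma dlog_W_even m x : orthant x -> (1 <= m < l.+1)%N ->
  dlog W x (bvec _ m.*2) (- (crd x m.*2)^-1).
Proof.
move=> Qx m_l; rewrite -[- _]add0r; apply: dlog_div.
- by rewrite gt_eqF// prodr_gt0// => j _; exact: crd_gt0.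
- rewrite -(@sum_delta0 _ (fun j => (crd x j.*2.+1 + 1)^-1) l.+1 0 l.+1) ?ltnn ?andbF//.
  apply: dlog_prod => j; rewrite mem_index_iota => jn.
  rewrite (_ : (j == l.+1) = (j.*2.+1 == m.*2)); last by apply/eqP/eqP; lia.
  by apply: dlog_crdD1 => //; lia.
rewrite -(@sum_delta _ (fun j => (crd x j.*2)^-1) m 1 l.+1)//.
apply: dlog_prod => j; rewrite mem_index_iota => jn.
rewrite (_ : (j == m) = (j.*2 == m.*2)); last by apply/eqP/eqP; lia.
by apply: dlog_crd; [exact: crd_neq0|lia|lia].
Qed.

Lemma dlog_W_odd m x : orthant x -> (m < l.+1)%N ->
  dlog W x (bvec _ m.*2.+1) (crd x m.*2.+1 + 1)^-1.
Proof.
move=> Qx m_l; rewrite -[_^-1]subr0; apply: dlog_div.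
- by rewrite gt_eqF// prodr_gt0// => j _; exact: crd_gt0.
- rewrite -(@sum_delta _ (fun j => (crd x j.*2.+1 + 1)^-1) m 0 l.+1)//.
  apply: dlog_prod => j; rewrite mem_index_iota => jn.
  rewrite (_ : (j == m) = (j.*2.+1 == m.*2.+1)); last by apply/eqP/eqP; lia.
  by apply: dlog_crdD1 => //; lia.
rewrite -(@sum_delta0 _ (fun j => (crd x j.*2)^-1) 0 1 l.+1)//.
apply: dlog_prod => j; rewrite mem_index_iota => jn.
rewrite (_ : (j == 0)%N = (j.*2 == m.*2.+1)); last by apply/eqP/eqP; lia.
by apply: dlog_crd; [exact: crd_neq0|lia|lia].
Qed.

End lyness_W_log_derivatives.

Section lyness_W_gradients.
Context {R : realType} (l : nat) (a : R).
Hypothesis a_ge0 : 0 <= a.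
Implicit Types x : 'rV[R]_(l.*2.+1).
Local Notation F := (lyness a l.*2).
Local Notation W := (lyness_W l).

(** Unlike [lyness_W_lyness], this formula needs no positivity, hence it can be
    differentiated at once. *)
Lemma W_lyness_expand : (fun x => W (F x)) = fun x =>
  (\prod_(1 <= j < l.+1) (crd x j.*2 + 1))
  * ((a + \sum_(2 <= j < l.*2.+2) crd x j) / crd x 1 + 1)
  / \prod_(1 <= j < l.+1) crd x j.*2.+1.
Proof.
apply/funext => x; rewrite /lyness_W [X in X / _]big_nat_recr//= crd_lyness_last.
congr (_ * _ / _).
  by rewrite [RHS]big_add1/=; apply: eq_big_nat => j j_l; rewrite crd_lyness//; lia.
by apply: eq_big_nat => j j_l; rewrite crd_lyness//; lia.
Qed.

Let T x := a + \sum_(1 <= j < l.*2.+2) crd x j.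

Let dlog_last i x : orthant x -> (1 < i < l.*2.+2)%N ->
  dlog (fun y : 'rV[R]_(l.*2.+1) =>
    (a + \sum_(2 <= j < l.*2.+2) crd y j) / crd y 1 + 1) x (bvec _ i) (T x)^-1.
Proof.
move=> Qx i_l; have x1 := crd_gt0 1 Qx; have x0 := crd_neq0 1 Qx.
have TE : (a + \sum_(2 <= j < l.*2.+2) crd x j) / crd x 1 + 1 = T x / crd x 1.
  by rewrite /T [in RHS]big_ltn//; field.
have T0 : T x != 0.
  rewrite gt_eqF// /T big_ltn// addrCA ltr_wpDr//; exact: sum_crd_ge0.
rewrite /dlog TE -[X in hasD _ _ _ X]addr0; apply: (hasDD _ (hasD_cst 1 _ _)).
have i1 : (1 <= i < l.*2.+2)%N by lia.
have d0 : hasD (fun y : 'rV[R]_(l.*2.+1) => crd y 1) x (bvec _ i) 0.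
  have := @hasD_crd R _ i 1 x i1 isT.
  by rewrite [1%N == i]ltn_eqF//; lia.
have d1 : dlog (fun y : 'rV[R]_(l.*2.+1) => crd y 1) x (bvec _ i) 0.
  by rewrite /dlog mulr0.
have := hasDM (@hasD_sum_crd R _ a i x 1 i_l) (dlogV x0 d1).
by rewrite oppr0 !mulr0 mulr1 add0r mulrAC divff// mul1r.
Qed.

Lemma dlog_W_lyness_even m x : orthant x -> (1 <= m < l.+1)%N ->
  dlog (fun y => W (F y)) x (bvec _ m.*2) ((T x)^-1 + (crd x m.*2 + 1)^-1).
Proof.
move=> Qx m_l; rewrite -[X in dlog _ _ _ X]subr0 (addrC (T x)^-1).
rewrite W_lyness_expand.
apply: dlog_div.
- by rewrite gt_eqF// prodr_gt0// => j _; exact: crd_gt0.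
- apply: dlogM; last by apply: dlog_last => //; lia.
  rewrite -(@sum_delta _ (fun j => (crd x j.*2 + 1)^-1) m 1 l.+1)//.
  apply: dlog_prod => j; rewrite mem_index_iota => jn.
  rewrite (_ : (j == m) = (j.*2 == m.*2)); last by apply/eqP/eqP; lia.
  by apply: dlog_crdD1 => //; lia.
rewrite -(@sum_delta0 _ (fun j => (crd x j.*2.+1)^-1) 0 1 l.+1)//.
apply: dlog_prod => j; rewrite mem_index_iota => jn.
rewrite (_ : (j == 0)%N = (j.*2.+1 == m.*2)); last by apply/eqP/eqP; lia.
by apply: dlog_crd; [exact: crd_neq0|lia|lia].
Qed.

Lemma dlog_W_lyness_odd m x : orthant x -> (1 <= m < l.+1)%N ->
  dlog (fun y => W (F y)) x (bvec _ m.*2.+1) ((T x)^-1 - (crd x m.*2.+1)^-1).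
Proof.
move=> Qx m_l; rewrite -[(T x)^-1]add0r.
rewrite W_lyness_expand.
apply: dlog_div.
- by rewrite gt_eqF// prodr_gt0// => j _; exact: crd_gt0.
- apply: dlogM; last by apply: dlog_last => //; lia.
  rewrite -(@sum_delta0 _ (fun j => (crd x j.*2 + 1)^-1) 0 1 l.+1)//.
  apply: dlog_prod => j; rewrite mem_index_iota => jn.
  rewrite (_ : (j == 0)%N = (j.*2 == m.*2.+1)); last by apply/eqP/eqP; lia.
  by apply: dlog_crdD1 => //; lia.
rewrite -(@sum_delta _ (fun j => (crd x j.*2.+1)^-1) m 1 l.+1)//.
apply: dlog_prod => j; rewrite mem_index_iota => jn.
rewrite (_ : (j == m) = (j.*2.+1 == m.*2.+1)); last by apply/eqP/eqP; lia.
by apply: dlog_crd; [exact: crd_neq0|lia|lia].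
Qed.

Lemma dlog_V3 i x c c' :
  dlog W x (bvec _ i) c -> dlog (fun y => W (F y)) x (bvec _ i) c' ->
  hasD (lyness_V3 a l) x (bvec _ i) (W x * c + W (F x) * c').
Proof. by move=> dW dW'; exact: hasDD dW dW'. Qed.

End lyness_W_gradients.

(** * Nonvanishing of rational functions on a dense open set *)

Section rational_on_segments.
Context {R : realType} (n : nat).
Implicit Types (x y : 'rV[R]_n) (f g : 'rV[R]_n -> R).

(** [ratl f]: f is continuous on the positive orthant, and restricts on every
    segment of the orthant to a quotient of two polynomials in the parameter,
    with a nonvanishing denominator. *)
Definition ratl f :=
  (forall x, orthant x -> {for x, continuous f}) /\
  (forall x y, orthant x -> orthant y -> exists p q : {poly R},
    forall t, 0 <= t <= 1 ->
      q.[t] != 0 /\ f (x + t *: (y - x)) = p.[t] / q.[t]).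

Lemma orthant_segment x y (t : R) : orthant x -> orthant y -> 0 <= t <= 1 ->
  orthant (x + t *: (y - x)).
Proof.
move=> Qx Qy /andP[t0 t1] i; rewrite !mxE.
have -> : x ord0 i + t * (y ord0 i - x ord0 i) =
          (1 - t) * x ord0 i + t * y ord0 i by ring.
have := Qx i; have := Qy i; rewrite /= => yi xi.
by have [t2|t2] := lerP t 2^-1; nra.
Qed.

Lemma ratl_cst c : ratl (fun=> c).
Proof.
split; first by move=> x _; exact: cst_continuous.
move=> x y _ _; exists c%:P, 1 => t _.
by rewrite !hornerC divr1 oner_eq0.
Qed.

Lemma ratl_coord i : ratl (fun x => x ord0 i).
Proof.
split; first by move=> x _; exact: coord_continuous.
move=> x y _ _; exists ((x ord0 i)%:P + (y ord0 i - x ord0 i) *: 'X), 1 => t _.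
by rewrite !hornerE oner_eq0 !mxE divr1; split=> //; ring.
Qed.

Lemma ratlD f g : ratl f -> ratl g -> ratl (fun x => f x + g x).
Proof.
move=> [cf rf] [cg rg]; split=> [x Qx|x y Qx Qy].
  exact: (continuousD (cf x Qx) (cg x Qx)).
have [p [q Hf]] := rf x y Qx Qy; have [p' [q' Hg]] := rg x y Qx Qy.
exists (p * q' + p' * q), (q * q') => t t01.
have [q0 ->] := Hf t t01; have [q'0 ->] := Hg t t01.
rewrite !(hornerD, hornerM) mulf_neq0//; split=> //.
by field; apply/andP.
Qed.

Lemma ratlM f g : ratl f -> ratl g -> ratl (fun x => f x * g x).
Proof.
move=> [cf rf] [cg rg]; split=> [x Qx|x y Qx Qy].
  exact: (continuousM (cf x Qx) (cg x Qx)).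
have [p [q Hf]] := rf x y Qx Qy; have [p' [q' Hg]] := rg x y Qx Qy.
exists (p * p'), (q * q') => t t01.
have [q0 ->] := Hf t t01; have [q'0 ->] := Hg t t01.
rewrite !hornerM mulf_neq0//; split=> //.
by field; apply/andP.
Qed.

Lemma ratlN f : ratl f -> ratl (fun x => - f x).
Proof.
move=> rf; rewrite (_ : (fun _ => _) = fun x => (-1) * f x).
  by apply: ratlM => //; exact: ratl_cst.
by apply/funext => x; rewrite mulN1r.
Qed.

Lemma ratlB f g : ratl f -> ratl g -> ratl (fun x => f x - g x).
Proof. by move=> rf rg; apply: ratlD => //; exact: ratlN. Qed.

Lemma ratlV f : (forall x, orthant x -> f x != 0) -> ratl f ->
  ratl (fun x => (f x)^-1).
Proof.
move=> f0 [cf rf]; split=> [x Qx|x y Qx Qy].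
  exact: (continuousV (f0 x Qx) (cf x Qx)).
have [p [q H]] := rf x y Qx Qy; exists q, p => t t01.
have [q0 fE] := H t t01; rewrite fE invf_div; split=> //.
have := f0 _ (orthant_segment Qx Qy t01); rewrite fE.
by apply: contra_neq => ->; rewrite mul0r.
Qed.

Lemma ratl_sum (r : seq nat) (h : nat -> 'rV[R]_n -> R) :
  (forall i, ratl (h i)) -> ratl (fun x => \sum_(i <- r) h i x).
Proof.
move=> rh; elim: r => [|i r IH].
  rewrite (_ : (fun _ => _) = fun=> 0); first exact: ratl_cst.
  by apply/funext => x; rewrite big_nil.
rewrite (_ : (fun _ => _) = fun x => h i x + \sum_(j <- r) h j x).
  exact: ratlD.
by apply/funext => x; rewrite big_cons.
Qed.

Lemma ratl_prod (r : seq nat) (h : nat -> 'rV[R]_n -> R) :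
  (forall i, ratl (h i)) -> ratl (fun x => \prod_(i <- r) h i x).
Proof.
move=> rh; elim: r => [|i r IH].
  rewrite (_ : (fun _ => _) = fun=> 1); first exact: ratl_cst.
  by apply/funext => x; rewrite big_nil.
rewrite (_ : (fun _ => _) = fun x => h i x * \prod_(j <- r) h j x).
  exact: ratlM.
by apply/funext => x; rewrite big_cons.
Qed.

Lemma open_orthant : open (@orthant R n).
Proof.
rewrite openE => x Qx; rewrite /interior /=.
exists (fun _ _ => [set r : R | 0 < r]) => [i j|y Py i]; last exact: Py.
by apply: open_nbhs_nbhs; split; [exact: open_gt|rewrite (ord1 i); exact: Qx].
Qed.

(** A rational function that does not vanish identically on the orthant is
    nonzero on a dense open subset: along the segment to a point where it is
    nonzero, it has finitely many zeros. *)
Lemma ratl_neq0_dense f y0 : ratl f -> orthant y0 -> f y0 != 0 ->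
  let U := [set x | orthant x /\ f x != 0] in
  open U /\ @orthant R n `<=` closure U.
Proof.
move=> [cf rf] Qy0 fy0 U; split.
  rewrite openE => x [Qx fx0]; rewrite /interior.
  have H1 : nbhs x (@orthant R n).
    by apply: open_nbhs_nbhs; split => //; exact: open_orthant.
  have H2 : (f @ x) [set r | r != 0].
    exact: (cvgr_neq0 (f x) (cf x Qx) fx0).
  by apply: filterS2 H1 H2 => y Qy fy; split.
move=> x Qx B nB.
have [p [q pq]] := rf x y0 Qx Qy0.
have p0 : p != 0.
  have t1 : 0 <= (1 : R) <= 1 by rewrite ler01 lexx.
  have [_] := pq 1 t1; rewrite scale1r addrC subrK => fE.
  by apply: contra_neq fy0 => p0; rewrite fE p0 horner0 mul0r.
have cseg : {for (0 : R), continuous (fun t : R => x + t *: (y0 - x))}.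
  by move=> t; apply: cvgD; [exact: cvg_cst|apply: cvgZr_tmp; exact: cvg_id].
have : \forall t \near (0 : R), B (x + t *: (y0 - x)).
  by apply: cseg; rewrite scale0r addr0.
move=> /nbhs_ballP[e /= e0 eB].
(* the parameters d / (i + 2), for i below the size of p, cannot all be roots *)
pose d := Num.min e 1; have d0 : 0 < d by rewrite lt_min e0 ltr01.
pose s := [seq d / i.+2%:R | i <- iota 0 (size p)].
have us : uniq s.
  rewrite map_inj_in_uniq ?iota_uniq// => i j _ _ /(mulfI (lt0r_neq0 d0)).
  by move=> /invr_inj/eqP; rewrite eqr_nat => /eqP[].
have [t ts pt0] : exists2 t, t \in s & p.[t] != 0.
  have [/allP sroot|/allPn[t ts]] := boolP (all (root p) s).
    by have := max_poly_roots p0 (introT allP sroot) us; rewrite size_map size_iota ltnn.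
  by rewrite /root => pt; exists t.
have [t0 td] : 0 < t /\ t < d.
  move: ts => /mapP[i _ ->]; rewrite divr_gt0//; split=> //.
  by rewrite ltr_pdivrMr// ltr_pMr// (ltr_nat _ 1).
have t01 : 0 <= t <= 1.
  by rewrite ltW//= ltW// (lt_le_trans td)// ge_min lexx orbT.
exists (x + t *: (y0 - x)); split.
  split; first exact: orthant_segment.
  by have [q0 ->] := pq t t01; rewrite mulf_neq0// invr_eq0.
apply: eB; rewrite /ball/= sub0r normrN gtr0_norm//.
by rewrite (lt_le_trans td)// ge_min lexx.
Qed.

End rational_on_segments.

(** * Functional independence of V1, V2 and V3 *)

(** The determinant of the matrix of rows a, b and c. *)
Definition det3 (R : pzRingType) (a1 a2 a3 b1 b2 b3 c1 c2 c3 : R) : R :=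
  a1 * (b2 * c3 - b3 * c2) - a2 * (b1 * c3 - b3 * c1) + a3 * (b1 * c2 - b2 * c1).

Lemma cramer3 (R : fieldType) (a1 a2 a3 b1 b2 b3 c1 c2 c3 s t u : R) :
  det3 a1 a2 a3 b1 b2 b3 c1 c2 c3 != 0 ->
  s * a1 + t * b1 + u * c1 = 0 ->
  s * a2 + t * b2 + u * c2 = 0 ->
  s * a3 + t * b3 + u * c3 = 0 -> [/\ s = 0, t = 0 & u = 0].
Proof.
move=> d0 e1 e2 e3.
have zero r : r * det3 a1 a2 a3 b1 b2 b3 c1 c2 c3 = 0 -> r = 0.
  by move=> /eqP; rewrite mulf_eq0 (negbTE d0) orbF => /eqP.
split; apply: zero; rewrite /det3.
- transitivity ((s * a1 + t * b1 + u * c1) * (b2 * c3 - b3 * c2)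
    - (s * a2 + t * b2 + u * c2) * (b1 * c3 - b3 * c1)
    + (s * a3 + t * b3 + u * c3) * (b1 * c2 - b2 * c1)); first by ring.
  by rewrite e1 e2 e3; ring.
- transitivity (- (s * a1 + t * b1 + u * c1) * (a2 * c3 - a3 * c2)
    + (s * a2 + t * b2 + u * c2) * (a1 * c3 - a3 * c1)
    - (s * a3 + t * b3 + u * c3) * (a1 * c2 - a2 * c1)); first by ring.
  by rewrite e1 e2 e3; ring.
- transitivity ((s * a1 + t * b1 + u * c1) * (a2 * b3 - a3 * b2)
    - (s * a2 + t * b2 + u * c2) * (a1 * b3 - a3 * b1)
    + (s * a3 + t * b3 + u * c3) * (a1 * b2 - a2 * b1)); first by ring.
  by rewrite e1 e2 e3; ring.
Qed.

Lemma ratl_det3 (R : realType) (n : nat)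
    (a1 a2 a3 b1 b2 b3 c1 c2 c3 : 'rV[R]_n -> R) :
  ratl a1 -> ratl a2 -> ratl a3 -> ratl b1 -> ratl b2 -> ratl b3 ->
  ratl c1 -> ratl c2 -> ratl c3 ->
  ratl (fun x => det3 (a1 x) (a2 x) (a3 x) (b1 x) (b2 x) (b3 x)
                      (c1 x) (c2 x) (c3 x)).
Proof.
move=> ra1 ra2 ra3 rb1 rb2 rb3 rc1 rc2 rc3.
apply: ratlD; last by apply: ratlM ra3 _; apply: ratlB; exact: ratlM.
apply: ratlB; first by apply: ratlM ra1 _; apply: ratlB; exact: ratlM.
by apply: ratlM ra2 _; apply: ratlB; exact: ratlM.
Qed.

Section independence.
Context {R : realType} (l : nat) (a : R).
Hypothesis l_gt1 : (1 < l)%N.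
Hypothesis a_ge0 : 0 <= a.
Implicit Types x : 'rV[R]_(l.*2.+1).
Local Notation F := (lyness a l.*2).
Local Notation W := (lyness_W l).
Local Notation Q := (@orthant R l.*2.+1).

Let T x := a + \sum_(1 <= j < l.*2.+2) crd x j.

Let T_gt0 x : orthant x -> 0 < T x.
Proof.
move=> Qx; rewrite /T big_ltn// addrCA ltr_wpDr ?crd_gt0//.
exact: sum_crd_ge0.
Qed.

(* logarithmic derivatives of W, of W o F and of V2 along the i-th vector of the
   canonical basis, for i = 2, 3, 4 *)
Let w i x := if odd i then (crd x i + 1)^-1 else - (crd x i)^-1.
Let w' i x := (T x)^-1 + if odd i then - (crd x i)^-1 else (crd x i + 1)^-1.
Let v i x := (T x + crd x 1 * crd x l.*2.+1)^-1
   + ((1 + crd x i + crd x i.+1)^-1 + (1 + crd x i.-1 + crd x i)^-1)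
   - (crd x i)^-1.

Let dw i x : orthant x -> (1 < i < 5)%N -> dlog W x (bvec _ i) (w i x).
Proof.
move=> Qx; case: i => [|[|[|[|[|i]]]]]//= _.
- by apply: (@dlog_W_even _ _ 1) => //; lia.
- by apply: (@dlog_W_odd _ _ 1) => //; lia.
- by apply: (@dlog_W_even _ _ 2) => //; lia.
Qed.

Let dw' i x : orthant x -> (1 < i < 5)%N ->
  dlog (fun y => W (F y)) x (bvec _ i) (w' i x).
Proof.
move=> Qx; case: i => [|[|[|[|[|i]]]]]//= _.
- by apply: (@dlog_W_lyness_even _ _ _ _ 1) => //; lia.
- by apply: (@dlog_W_lyness_odd _ _ _ _ 1) => //; lia.
- by apply: (@dlog_W_lyness_even _ _ _ _ 2) => //; lia.
Qed.

Let delta x :=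
  det3 (w 2 x) (w 3 x) (w 4 x) (w' 2 x) (w' 3 x) (w' 4 x)
       (v 2 x) (v 3 x) (v 4 x).

Let dV1 i x : orthant x -> (1 < i < 5)%N ->
  hasD (lyness_V1 a l.*2) x (bvec _ i) (lyness_V1 a l.*2 x * (w i x + w' i x)).
Proof.
move=> Qx i5; rewrite (_ : w i x + w' i x =
   (T x)^-1 + (crd x i + 1)^-1 - (crd x i)^-1); last first.
  by rewrite /w /w'; case: odd; ring.
by apply: dlog_V1 => //; lia.
Qed.

Let dV2 i x : orthant x -> (1 < i < 5)%N ->
  hasD (lyness_V2 a l.*2) x (bvec _ i) (lyness_V2 a l.*2 x * v i x).
Proof. by move=> Qx i5; apply: dlog_V2 => //; lia. Qed.

Let dV3 i x : orthant x -> (1 < i < 5)%N ->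
  hasD (lyness_V3 a l) x (bvec _ i) (W x * w i x + W (F x) * w' i x).
Proof. by move=> Qx i5; apply: dlog_V3; [exact: dw|exact: dw']. Qed.

Let V : 'I_3 -> 'rV[R]_(l.*2.+1) -> R^o :=
  tnth [tuple lyness_V1 a l.*2; lyness_V2 a l.*2; lyness_V3 a l].

Let gradientE f x i c : hasD f x (bvec l.*2 i) c ->
  gradient (f : _ -> R^o) x ord0 (inord i.-1) = c.
Proof. by move=> [df <-]; rewrite mxE deriveE. Qed.

Let V2_gt0 x : orthant x -> 0 < lyness_V2 a l.*2 x.
Proof.
move=> Qx; rewrite divr_gt0 ?lyness_Pi_gt0// mulr_gt0//.
  by rewrite addr_gt0 ?T_gt0// mulr_gt0 ?crd_gt0.
by rewrite prodr_gt0// => i _; rewrite !addr_gt0 ?crd_gt0.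
Qed.

(** A linear relation between the three gradients, restricted to the second,
    third and fourth coordinates, is a linear relation between the rows of the
    determinant delta. *)
Lemma row_free_gradients x : orthant x -> delta x * (W x - W (F x)) != 0 ->
  (forall i, differentiable (V i) x) /\
  row_free (\matrix_(i < 3) gradient (V i) x).
Proof.
move=> Qx; rewrite mulf_eq0 negb_or => /andP[delta0 WF0]; split.
  move=> i; rewrite /V; case: i => -[|[|[|//]]] i3; rewrite (tnth_nth (cst 0))/=.
  - by have [] := @dV1 2 x Qx isT.
  - by have [] := @dV2 2 x Qx isT.
  - by have [] := @dV3 2 x Qx isT.
apply: inj_row_free => u uM.
have E i : (1 < i < 5)%N ->
    (u ord0 ord0 * lyness_V1 a l.*2 x + u ord0 ord_max * W x) * w i x
    + (u ord0 ord0 * lyness_V1 a l.*2 x + u ord0 ord_max * W (F x)) * w' i x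
    + (u ord0 (lift ord0 ord0) * lyness_V2 a l.*2 x) * v i x = 0.
  move=> i5; have := congr1 (fun M : 'rV_(l.*2.+1) => M ord0 (inord i.-1)) uM.
  rewrite !mxE !big_ord_recl big_ord0 !(@mxE _ 3 l.*2.+1).
  rewrite /V !(tnth_nth (cst 0))/=.
  rewrite (gradientE (dV1 Qx i5)) (gradientE (dV2 Qx i5)) (gradientE (dV3 Qx i5)).
  move=> <-; rewrite (_ : lift ord0 (lift ord0 ord0) = ord_max); last exact/val_inj.
  by ring.
have [e1 e2 e3] := cramer3 delta0 (E 2 isT) (E 3 isT) (E 4 isT).
have u3 : u ord0 ord_max = 0.
  have : u ord0 ord_max * (W x - W (F x)) = 0.
    transitivity ((u ord0 ord0 * lyness_V1 a l.*2 x + u ord0 ord_max * W x)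
      - (u ord0 ord0 * lyness_V1 a l.*2 x + u ord0 ord_max * W (F x))).
      by ring.
    by rewrite e1 e2 subrr.
  by move=> /eqP; rewrite mulf_eq0 (negbTE WF0) orbF => /eqP.
have u2 : u ord0 (lift ord0 ord0) = 0.
  by move/eqP: e3; rewrite mulf_eq0 (gt_eqF (V2_gt0 Qx)) orbF => /eqP.
have u1 : u ord0 ord0 = 0.
  move/eqP: e1; rewrite u3 mul0r addr0 mulf_eq0 lyness_V1E// mulf_eq0.
  have QFx : orthant (F x) by apply: lyness_orthant => //; rewrite double_gt0; lia.
  by rewrite (gt_eqF (lyness_W_gt0 Qx)) (gt_eqF (lyness_W_gt0 QFx)) !orbF => /eqP.
apply/rowP => i; rewrite mxE; case: i => -[|[|[|//]]] i3.
- by rewrite -[RHS]u1; congr (u _ _); exact/val_inj.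
- by rewrite -[RHS]u2; congr (u _ _); exact/val_inj.
- by rewrite -[RHS]u3; congr (u _ _); exact/val_inj.
Qed.

Let ratl_crd i : ratl (fun x => crd x i).
Proof. exact: ratl_coord. Qed.

Let ratl_crdV i : ratl (fun x => (crd x i)^-1).
Proof. by apply: ratlV => // x; exact: crd_neq0. Qed.

Let ratl_crd1 i : ratl (fun x => crd x i + 1).
Proof. by apply: ratlD => //; exact: ratl_cst. Qed.

Let ratl_crd1V i : ratl (fun x => (crd x i + 1)^-1).
Proof. by apply: ratlV => // x Qx; rewrite gt_eqF// addr_gt0// crd_gt0. Qed.

Let ratl_T : ratl T.
Proof. by apply: ratlD; [exact: ratl_cst|exact: ratl_sum]. Qed.

Let ratl_w i : ratl (w i).
Proof. by rewrite /w; case: odd => //; exact: ratlN. Qed.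

Let ratl_w' i : ratl (w' i).
Proof.
apply: ratlD.
  by apply: ratlV => [x Qx|]; [rewrite gt_eqF// T_gt0|exact: ratl_T].
by case: odd => //; exact: ratlN.
Qed.

Let ratl_link i : ratl (fun x => (1 + crd x i + crd x i.+1)^-1).
Proof.
apply: ratlV => [x Qx|]; first by rewrite gt_eqF// !addr_gt0// crd_gt0.
by apply: ratlD => //; apply: ratlD => //; exact: ratl_cst.
Qed.

Let ratl_v i : (0 < i)%N -> ratl (v i).
Proof.
move=> i0; apply: ratlB => //; apply: ratlD.
  apply: ratlV => [x Qx|].
    by rewrite gt_eqF// addr_gt0// ?T_gt0// mulr_gt0// crd_gt0.
  by apply: ratlD; [exact: ratl_T|exact: ratlM].
by apply: ratlD => //; have := ratl_link i.-1; rewrite prednK.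
Qed.

(* the value of W (F x) at a point x of the orthant *)
Let WF x := T x * (\prod_(1 <= j < l.+1) (crd x j.*2 + 1))
  / \prod_(0 <= j < l.+1) crd x j.*2.+1.

Let ratl_phi : ratl (fun x => delta x * (W x - WF x)).
Proof.
apply: ratlM.
  apply: (ratl_det3 (ratl_w 2) (ratl_w 3) (ratl_w 4)
           (ratl_w' 2) (ratl_w' 3) (ratl_w' 4)); exact: ratl_v.
have ratl_odd : ratl (fun x => (\prod_(0 <= j < l.+1) crd x j.*2.+1)^-1).
  apply: ratlV => [x Qx|]; last exact: ratl_prod.
  by rewrite gt_eqF// prodr_gt0// => j _; exact: crd_gt0.
have ratl_even : ratl (fun x => (\prod_(1 <= j < l.+1) crd x j.*2)^-1).
  apply: ratlV => [x Qx|]; last exact: ratl_prod.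
  by rewrite gt_eqF// prodr_gt0// => j _; exact: crd_gt0.
apply: ratlB; first by apply: ratlM => //; apply: ratl_prod.
by do 2?apply: ratlM => //; exact: ratl_prod.
Qed.

(* At this point the first and the third columns of the determinant differ only
   in their last entry, so it reduces to a determinant of size 2. *)
Let phi_pt : delta (axis_pt 2^-1) * (W (axis_pt 2^-1) - WF (axis_pt 2^-1)) != 0.
Proof.
have h0 : 0 < (2^-1 : R) by rewrite invr_gt0.
have Qp := orthant_pt (n := l.*2) h0.
have TE : T (axis_pt 2^-1) = a + (2^-1 + l.*2%:R) by rewrite /T sum_pt.
have T4 : 4 < T (axis_pt 2^-1).
  have : (4 : R) <= l.*2%:R by rewrite ler_nat; lia.
  by rewrite TE; have := a_ge0; lra.
rewrite -/(T _) in TE; have T0 : T (axis_pt 2^-1) != 0 by rewrite gt_eqF// (lt_trans _ T4).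
rewrite mulf_neq0//.
  have -> : delta (axis_pt 2^-1) = 15^-1 * (3 / 2 / T (axis_pt 2^-1) - 3 / 4).
    rewrite /delta /det3 /w /w' /v /= !crd_pt1 !crd_pt//; do ?lia.
    have M0 : T (axis_pt 2^-1) + 2^-1 != 0 by rewrite gt_eqF// addr_gt0// (lt_trans _ T4).
    move: (T _) T0 M0 T4 => t T0 M0 T4; field.
    by rewrite T0 (_ : t * 2 + 1 = 2 * (t + 2^-1)) ?mulf_neq0//; field.
  rewrite mulf_neq0 ?invr_neq0// subr_eq0 lt_eqF// ltr_pdivrMr ?(lt_trans _ T4)//.
  by move: (T _) T4 => t T4; lra.
rewrite subr_eq0 lyness_W_pt -[WF _]lyness_W_lyness//.
rewrite lyness_W_lyness_pt// ?(ltnW l_gt1)//.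
rewrite -TE invrK mulrAC lt_eqF// ltr_pM2r ?exprn_gt0//.
by move: (T _) T4 => t T4; lra.
Qed.

Lemma independent_V1_V2_V3 : functionally_independent Q V.
Proof.
have h0 : 0 < (2^-1 : R) by rewrite invr_gt0.
have [oU dU] := ratl_neq0_dense ratl_phi (orthant_pt h0) phi_pt.
eexists; split; [exact: oU|by move=> x []|exact: dU|].
move=> x [Qx phix]; apply: row_free_gradients => //.
by rewrite lyness_W_lyness.
Qed.

End independence.

(** * Measures with a density *)

(** The identity 1 / x = x (x^2)^(-1) reduces the inverse, at 0 included, to a
    power of a nonnegative number. *)
Lemma measurable_inv (R : realType) :
  measurable_fun [set: measurableTypeR R] (fun x : measurableTypeR R => x^-1 : R).
Proof.
rewrite (_ : (fun x => _) = fun x : R => x * (x ^+ 2) `^ (- 1)).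
  apply: measurable_funM => //.
  by apply: (measurableT_comp (measurable_powR _)); exact: measurable_funX.
apply/funext => x; rewrite powR_inv1 ?sqr_ge0//.
by have [->|x0] := eqVneq x 0; [rewrite invr0 mul0r|field].
Qed.

Lemma measurable_funV d (T : measurableType d) (R : realType) (f : T -> R) :
  measurable_fun [set: T] f -> measurable_fun [set: T] (fun x => (f x)^-1).
Proof. by move=> mf; exact: (measurableT_comp (@measurable_inv R) mf). Qed.

Section mdensity.
Local Open Scope ereal_scope.
Context d (T : measurableType d) (R : realType).
Variables (mu : {measure set T -> \bar R}) (w : T -> R).
Hypotheses (mw : measurable_fun [set: T] w) (w0 : forall x, (0 <= w x)%R).

(** The measure of density w with respect to mu. The two hypotheses on w are
    arguments, as they are needed for this set function to be a measure. *)
Definition mdensity of measurable_fun [set: T] w & (forall x, (0 <= w x)%R) :=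
  fun A : set T => \int[mu]_(x in A) (w x)%:E.

Local Notation nu := (mdensity mw w0).

Let mwE D : measurable_fun D (EFin \o w).
Proof. by apply/measurable_EFinP; exact: measurable_funTS. Qed.

Let mdensity0 : nu set0 = 0.
Proof. by rewrite /mdensity integral_set0. Qed.

Let mdensity_ge0 A : 0 <= nu A.
Proof. by apply: integral_ge0 => x _; rewrite lee_fin. Qed.

Let mdensity_sigma_additive : semi_sigma_additive nu.
Proof.
move=> A mA tA mUA; rewrite /mdensity ge0_integral_bigcup//.
- by apply: is_cvg_ereal_nneg_natsum_cond => n _ _; exact: mdensity_ge0.
- by move=> x _; rewrite lee_fin.
Qed.

HB.instance Definition _ := isMeasure.Build _ _ _ nu
  mdensity0 mdensity_ge0 mdensity_sigma_additive.

Import HBNNSimple.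

Lemma ge0_integral_mdensity (f : T -> \bar R) :
  measurable_fun [set: T] f -> (forall x, 0 <= f x) ->
  \int[nu]_x f x = \int[mu]_x (f x * (w x)%:E).
Proof.
move=> mf f0; pose g := EFin \o w; pose h := nnsfun_approx measurableT mf.
have -> : \int[nu]_x f x = lim (\int[nu]_x (EFin \o h n) x @[n --> \oo]).
  have fE x : f x = lim ((EFin \o h n) x @[n --> \oo]).
    by apply/esym/cvg_lim => //; exact: cvg_nnsfun_approx.
  under eq_integral => x _ do rewrite fE.
  apply: monotone_convergence => //.
  - by move=> n; exact/measurable_EFinP.
  - by move=> n x _ //=; rewrite lee_fin.
  - by move=> x _ a b ab; rewrite lee_fin; exact/lefP/nd_nnsfun_approx.
have -> : \int[mu]_x (f \* g) x =
    lim (\int[mu]_x ((EFin \o h n) \* g) x @[n --> \oo]).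
  have fg x : f x * g x = lim (((EFin \o h n) \* g) x @[n --> \oo]).
    by apply/esym/cvg_lim => //; apply: cvgeZr => //; exact: cvg_nnsfun_approx.
  under eq_integral => x _ do rewrite fg.
  apply: monotone_convergence => //.
  - by move=> n; apply: emeasurable_funM => //; exact/measurable_EFinP.
  - by move=> n x _ /=; rewrite mule_ge0 ?lee_fin.
  - move=> x _ a b ab /=; rewrite lee_wpmul2r ?lee_fin//.
    exact/lefP/nd_nnsfun_approx.
suff suf n : \int[mu]_x ((EFin \o h n) x * g x) = \int[nu]_x (EFin \o h n) x.
  by under eq_fun do rewrite -suf.
transitivity (\int[nu]_x
   (\sum_(y \in range (h n)) (y * \1_(h n @^-1` [set y]) x)%:E)); last first.
  by apply: eq_integral => t _; rewrite /= fimfunE -fsumEFin.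
rewrite ge0_integral_fsum//; last 2 first.
- by move=> r; apply/measurable_EFinP; exact: measurable_funM.
- by move=> m y _; exact: nnfun_muleindic_ge0.
transitivity (\int[mu]_x (\sum_(y \in range (h n))
    (y * \1_(h n @^-1` [set y]) x)%:E * g x)).
  under [RHS]eq_integral => x _.
    rewrite -ge0_mule_fsuml => [|y]; last exact: nnfun_muleindic_ge0.
    rewrite fsumEFin // -(fimfunE _ x); over.
  by [].
rewrite ge0_integral_fsum//; last 2 first.
- move=> y; apply: emeasurable_funM => //.
  by apply/measurable_EFinP; exact: measurable_funM.
- move=> m y _; apply: mule_ge0; last by rewrite lee_fin.
  exact: nnfun_muleindic_ge0.
apply: eq_fsbigr => r rhn.
under [RHS]eq_integral do rewrite EFinM.
rewrite integralZl_indic_nnsfun => //.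
under eq_integral do rewrite EFinM -muleA.
rewrite ge0_integralZl//.
- under eq_integral do rewrite muleC.
  rewrite (eq_integral (g \_ (h n @^-1` [set r]))); last first.
    by move=> x xE; rewrite epatch_indic.
  by rewrite -integral_mkcond integral_indic// setIT.
- by apply: emeasurable_funM => //; exact/measurable_EFinP.
- by move=> t _; rewrite mule_ge0 ?lee_fin.
- by move: rhn; rewrite inE => -[t _ <-]; rewrite lee_fin.
Qed.

End mdensity.

(** * The measure dx / x on the half-line *)

Section dx_over_x.
Context {R : realType}.
Local Notation mR := (measurableTypeR R).
Local Notation leb := (@lebesgue_measure R).

(** The density of dx / x with respect to the Lebesgue measure on the line. *)
Definition omega (x : mR) : R := if 0 < x then x^-1 else 0.

Lemma omega_ge0 x : 0 <= omega x.
Proof. by rewrite /omega; case: ifPn => // x0; rewrite invr_ge0 ltW. Qed.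

Lemma measurable_omega : measurable_fun [set: mR] omega.
Proof.
apply: measurable_fun_ifT => //; last exact: measurable_inv.
exact: measurable_fun_ltr.
Qed.

(** The measure dx / x on the half-line, as a measure on the line. *)
Definition dxx : {measure set mR -> \bar R} :=
  mdensity leb measurable_omega omega_ge0.

Lemma dxx_itv (a b : R) : 0 < a -> a < b ->
  dxx `]a, b]%classic = (ln b - ln a)%:E.
Proof.
move=> a0 ab; transitivity (\int[leb]_(x in `]a, b]) (omega x)%:E)%E => //.
rewrite integral_itv_obnd_cbnd; last first.
  by apply/measurable_EFinP; apply: measurable_funTS; exact: measurable_omega.
rewrite (_ : (\int[leb]_(x in `[a, b]) (omega x)%:E =
              \int[leb]_(x in `[a, b]) (x^-1)%:E)%E); last first.
  apply: eq_integral => x /set_mem/=; rewrite in_itv/= => /andP[ax _].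
  by rewrite /omega (lt_le_trans a0 ax).
rewrite (@continuous_FTC2 _ _ (@ln R))//.
- apply: continuous_in_subspaceT => x /set_mem/=; rewrite in_itv/= => /andP[ax _].
  by apply: inv_continuous; rewrite gt_eqF// (lt_le_trans a0 ax).
- split.
  + move=> x; rewrite in_itv/= => /andP[ax _].
    by apply: ex_derive; apply: is_derive1_ln; exact: lt_trans ax.
  + by apply: cvg_at_right_filter; exact: continuous_ln.
  + by apply: cvg_at_left_filter; apply: continuous_ln; exact: lt_trans ab.
- move=> x; rewrite in_itv/= => /andP[ax _].
  rewrite derive1E; have [_ ->//] := is_derive1_ln (lt_trans a0 ax).
Qed.

Lemma dxx_nonpos (A : set mR) : measurable A -> A `<=` `]-oo, 0]%classic -> dxx A = 0%E.
Proof.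
move=> mA A0; transitivity (\int[leb]_(x in A) (omega x)%:E)%E => //.
rewrite integral0_eq// => x /A0/=.
by rewrite in_itv/= /omega ltNge => ->.
Qed.

(** The measure dx / x is the image of the Lebesgue measure by the exponential:
    its image by the logarithm gives length b - a to the interval from a to b. *)
Lemma dxx_expR (B : set mR) : measurable B ->
  dxx B = leb (@expR R @^-1` B).
Proof.
move=> mB.
have m0 : measurable (`]0, +oo[%classic : set mR) by exact: measurable_itv.
have mln : measurable_fun [set: mR] (@ln R : mR -> mR) by exact: measurable_ln.
pose nu := mrestr dxx m0.
have lnE A : measurable A -> leb A = pushforward nu (@ln R : mR -> mR) A.
  apply: lebesgue_measure_unique => _ [[a b] _ <-] /=.
  have [ba|ab] := leP b a.
    by rewrite set_itv_ge ?measure0// -leNgt.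
  rewrite lebesgue_measure_itv/= lte_fin ab /pushforward /nu /= /mrestr.
  rewrite (_ : _ `&` _ = `]expR a, expR b]%classic).
    by rewrite dxx_itv ?expR_gt0 ?ltr_expR// !expRK -EFinB.
  apply/seteqP; split=> x /=; rewrite !in_itv/= ?andbT.
    by move=> [/andP[ax xb] x0]; rewrite -(lnK x0) ltr_expR ler_expR ax.
  move=> /andP[ax xb]; have x0 := lt_trans (expR_gt0 a) ax.
  by split=> //; rewrite -ltr_expR -ler_expR lnK// ax.
rewrite lnE; last first.
  by rewrite -[X in measurable X]setTI; exact: measurable_expR.
rewrite (measureDI dxx mB m0) [X in (X + _)%E](_ : _ = 0%E) ?add0e; last first.
  apply: dxx_nonpos; first exact: measurableD.
  by move=> x [_] /=; rewrite !in_itv/= andbT leNgt => /negP.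
rewrite /pushforward /nu /= /mrestr; congr (dxx _); apply/seteqP; split=> x /=.
  by rewrite in_itv/= andbT => -[Bx x0]; rewrite lnK.
by rewrite in_itv/= andbT => -[+ x0]; rewrite lnK.
Qed.

Lemma lebesgue_reflection (s : R) (A : set mR) : measurable A ->
  leb ((fun t => s - t) @^-1` A) = leb A.
Proof.
move=> mA; have ms : measurable_fun [set: mR] (fun t : mR => s - t : mR).
  exact: measurable_funB.
apply/esym.
apply: (lebesgue_measure_unique (mu := pushforward leb (fun t : mR => s - t : mR))) => //.
move=> _ [[a b] _ <-] /=; rewrite /pushforward.
rewrite (_ : _ @^-1` _ = `[s - b, s - a[%classic).
  rewrite !lebesgue_measure_itv/= !lte_fin ltrD2l ltrN2.
  by case: ifPn => // _; rewrite -!EFinB; congr EFin; ring.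
by apply/seteqP; split=> t /=; rewrite !in_itv/=; lra.
Qed.

(** In the coordinate t = ln x, the inversion is t |-> ln c - t. *)
Lemma dxx_inversion (c : R) (B : set mR) : 0 < c -> measurable B ->
  dxx ((fun x => c / x) @^-1` B) = dxx B.
Proof.
move=> c0 mB.
have mi : measurable_fun [set: mR] (fun x : mR => c / x : mR).
  by apply: measurable_funM => //; exact: measurable_inv.
rewrite !dxx_expR//; last by rewrite -[X in measurable X]setTI; exact: mi.
rewrite -(lebesgue_reflection (ln c) (A := @expR R @^-1` B)); last first.
  by rewrite -[X in measurable X]setTI; exact: measurable_expR.
congr (leb _); apply/funext => t /=.
by rewrite expRD expRN lnK.
Qed.

Lemma integral_inversion (c : R) (g : mR -> \bar R) : 0 < c ->
  measurable_fun [set: mR] g -> (forall x, (0 <= g x)%E) ->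
  (\int[leb]_x (g (c / x)%R * (omega x)%:E) = \int[leb]_x (g x * (omega x)%:E))%E.
Proof.
move=> c0 mg g0; pose i (x : mR) : mR := c / x.
have mi : measurable_fun [set: mR] i.
  by apply: measurable_funM => //; exact: measurable_inv.
have mgi : measurable_fun [set: mR] (g \o i) := measurableT_comp mg mi.
have gi0 x : (0 <= (g \o i) x)%E by exact: g0.
rewrite -(ge0_integral_mdensity leb measurable_omega omega_ge0 mgi gi0).
rewrite -(ge0_integral_mdensity leb measurable_omega omega_ge0 mg g0).
transitivity (\int[pushforward dxx i]_x g x)%E.
  by rewrite ge0_integral_pushforward//= preimage_setT.
by apply: eq_measure_integral => A mA _; exact: dxx_inversion.
Qed.

End dx_over_x.

(** * Sets measurable in the sense of Caratheodory *)

Section caratheodory_decomposition.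
Local Open Scope ereal_scope.
Context d (T : measurableType d) (R : realType).
Variable mu : {sigma_finite_measure set T -> \bar R}.

Local Notation L := (caratheodory_type (mu^*)%mu).
Local Notation lam := (@completed_measure_extension _ _ _ mu).

Lemma caratheodory_measurable_base (A : set T) :
  measurable A -> measurable (A : set L).
Proof. exact: caratheodory_measurable_mu_ext. Qed.

Lemma completed_measureE (A : set T) : measurable A -> lam A = mu A.
Proof. exact: measurable_mu_extE. Qed.

(** Every set of finite outer measure has a measurable hull. *)
Lemma measurable_hull (X : set T) : (mu^*)%mu X < +oo ->
  exists B, [/\ measurable B, X `<=` B & mu B = (mu^*)%mu X].
Proof.
move=> Xoo; have Xfin : (mu^*)%mu X \is a fin_num.
  by rewrite ge0_fin_numE// mu_ext_ge0.
have /choice[A AX] : forall n : nat, exists A : (set T)^nat,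
    measurable_cover X A /\
    \sum_(k <oo) mu (A k) < (mu^*)%mu X + n.+1%:R^-1%:E.
  move=> n; have n0 : (0 < n.+1%:R^-1 :> R)%R by rewrite invr_gt0.
  by have [_ [A XA <-] ?] := lb_ereal_inf_adherent n0 Xfin; exists A.
have mU n : measurable (\bigcup_k A n k).
  by apply: bigcupT_measurable => k; exact: cover_measurable (AX n).1 k.
exists (\bigcap_n \bigcup_k A n k).
have mB : measurable (\bigcap_n \bigcup_k A n k).
  by apply: bigcapT_measurable => n; exact: mU.
have XB : X `<=` \bigcap_n \bigcup_k A n k.
  by move=> x Xx n _; exact: (cover_subset (AX n).1).
split=> //; apply/eqP; rewrite eq_le; apply/andP; split; last first.
  apply: (@le_trans _ _ (lam (\bigcap_n \bigcup_k A n k))).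
    exact: le_outer_measure.
  by rewrite completed_measureE.
apply/lee_addgt0Pr => _/posnumP[e]; near \oo => n.
apply: (@le_trans _ _ ((mu^*)%mu X + n.+1%:R^-1%:E)).
  apply: le_trans (ltW (AX n).2).
  apply: (@le_trans _ _ (mu (\bigcup_k A n k))).
    by apply: le_measure; rewrite ?inE//; exact: bigcap_inf.
  apply: measure_sigma_subadditive => //.
  by move=> k; exact: cover_measurable (AX n).1 k.
by rewrite leeD2l// lee_fin ltW//; near: n; exact: near_infty_natSinv_lt.
Unshelve. all: by end_near. Qed.

Lemma null_hull (X : set T) : (mu^*)%mu X = 0 ->
  exists N, [/\ measurable N, X `<=` N & mu N = 0].
Proof.
by move=> X0; have [|B] := @measurable_hull X; rewrite X0//; exists B.
Qed.

(** Up to a subset of a null set of the base sigma-algebra, a set measurable in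
    the sense of Caratheodory belongs to the base sigma-algebra. *)
Lemma caratheodory_decomposition (E : set L) : measurable E ->
  exists A N : set T,
    [/\ measurable A, measurable N, A `<=` E, E `\` A `<=` N & mu N = 0].
Proof.
move=> mE; have [S ST mS] := sigma_finiteT mu.
have /choice[AN ANP] : forall n : nat, exists AN : set T * set T,
    [/\ measurable AN.1, measurable AN.2, AN.1 `<=` E,
        (E `&` S n) `\` AN.1 `<=` AN.2 & mu AN.2 = 0].
  move=> n; have [mSn Snoo] := mS n.
  have mES : measurable (E `&` S n : set L).
    by apply: measurableI => //; exact: caratheodory_measurable_base.
  have ESoo : (mu^*)%mu (E `&` S n) < +oo.
    apply: (@le_lt_trans _ _ (lam (S n))); last by rewrite completed_measureE.
    by apply: le_outer_measure; exact: subIsetr.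
  have [H [mH EH HE]] := measurable_hull ESoo.
  have [N [mN HN N0]] : exists N, [/\ measurable N, H `\` (E `&` S n) `<=` N & mu N = 0].
    apply: null_hull; have mH' := caratheodory_measurable_base mH.
    have lamH : lam H = (mu^*)%mu (E `&` S n) by rewrite completed_measureE.
    have lamHoo : lam H < +oo by rewrite lamH.
    transitivity (lam H - lam (H `&` (E `&` S n))).
      exact: (measureD mH' mES lamHoo).
    rewrite setIidr// lamH subee// ge0_fin_numE//; exact: mu_ext_ge0.
  exists (H `\` N, N); split=> //=; first exact: measurableD.
    move=> x [Hx nNx]; apply: contrapT => nEx; apply: nNx; apply: HN.
    by split=> // -[].
  move=> x [Ex nHN]; apply: contrapT => nNx; apply: nHN; split=> //.
  exact: EH.
exists (\bigcup_n (AN n).1), (\bigcup_n (AN n).2); split.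
- by apply: bigcupT_measurable => n; have [] := ANP n.
- by apply: bigcupT_measurable => n; have [] := ANP n.
- by move=> x [n _]; have [_ _ + _ _] := ANP n; apply.
- move=> x [Ex nA]; have : (\bigcup_n S n) x by rewrite -ST.
  move=> [n _ Snx]; exists n => //; have [_ _ _ + _] := ANP n; apply.
  by split=> // Ax; apply: nA; exists n.
- have [] : mu.-negligible (\bigcup_n (AN n).2).
    apply: negligible_bigcup => n; have [_ ? _ _ ?] := ANP n.
    by exists (AN n).2; split.
  move=> B [mB B0 NB]; apply: (subset_measure0 _ mB NB B0).
  by apply: bigcupT_measurable => n; have [] := ANP n.
Qed.

(** Conversely, such a set is measurable in the sense of Caratheodory. *)
Lemma caratheodory_compose (E : set T) (A N : set T) :
  measurable A -> measurable N -> A `<=` E -> E `\` A `<=` N -> mu N = 0 ->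
  measurable (E : set L).
Proof.
move=> mA mN AE EAN N0.
rewrite -(setDUK AE); apply: measurableU; first exact: caratheodory_measurable_base.
apply: (@measure_is_complete_caratheodory _ _ (mu^*)%mu).
exists N; split=> //; first exact: caratheodory_measurable_base.
by have := completed_measureE mN; rewrite N0.
Qed.

Lemma measurable_fun_caratheodory d' (U : measurableType d') (f : T -> U) :
  measurable_fun [set: T] f -> measurable_fun [set: L] (f : L -> U).
Proof.
move=> mf _ Y mY; rewrite setTI; apply: caratheodory_measurable_base.
by rewrite -[X in measurable X]setTI; exact: mf.
Qed.

(** The integral of a function which is measurable for the base sigma-algebra
    can be computed on the part of E given by the decomposition. *)
Lemma ge0_integral_caratheodory (E : set L) (A N : set T) (f : T -> \bar R) :
  measurable A -> measurable N -> A `<=` E -> E `\` A `<=` N -> mu N = 0 ->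
  measurable_fun [set: T] f -> (forall x, 0 <= f x) ->
  \int[lam]_(x in E) f x = \int[mu]_(x in A) f x.
Proof.
move=> mA mN AE EAN N0 mf f0.
have mE : measurable E by exact: (caratheodory_compose mA mN).
have mfL := measurable_fun_caratheodory mf.
have mAL := caratheodory_measurable_base mA.
have mEA : measurable (E `\` A : set L) by exact: measurableD.
rewrite (@ge0_negligible_integral _ _ _ lam E (E `\` A))//; last 2 first.
- exact: measurable_funTS.
- apply/eqP; rewrite eq_le measure_ge0 andbT.
  have <- : lam N = 0 by rewrite completed_measureE.
  exact: le_outer_measure.
rewrite setDD setIidr//.
pose i (x : L) : T := x.
have mi : measurable_fun [set: L] i.
  by move=> _ Y mY; rewrite setTI; exact: caratheodory_measurable_base.
transitivity (\int[pushforward lam i]_(x in A) f x).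
  rewrite ge0_integral_pushforward//; exact: measurable_funTS.
by apply: eq_measure_integral => B mB _; exact: completed_measureE.
Qed.

End caratheodory_decomposition.

(** * Iterated integrals against the Lebesgue measure of R^n *)

Section lebesgue_rV_integrals.
Context {R : realType}.
Local Notation mR := (measurableTypeR R).
Local Notation leb := (@lebesgue_measure R).
Local Notation mu n := (lebesgue_rV R n).
Implicit Type n : nat.

(** The row vector obtained by appending a last coordinate. *)
Definition snoc_rV n (p : 'rV[R]_n * mR) : 'rV[R]_n.+1 :=
  \row_j if unlift ord_max j is Some i then p.1 ord0 i else p.2.

Lemma coor_snoc_rV_max n (p : 'rV[R]_n * mR) : snoc_rV p ord0 ord_max = p.2.
Proof. by rewrite mxE unlift_none. Qed.

Lemma coor_snoc_rV_lift n (p : 'rV[R]_n * mR) (j : 'I_n) :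
  snoc_rV p ord0 (lift ord_max j) = p.1 ord0 j.
Proof. by rewrite mxE liftK. Qed.

Lemma measurable_snoc_rV n : measurable_fun [set: 'rV[R]_n * mR] (@snoc_rV n).
Proof.
apply/measurable_fun_rVP => i; case: (unliftP ord_max i) => [j ->|->].
  rewrite (_ : _ \o _ = coor_rV j \o fst).
    by apply: measurableT_comp => //; exact: measurable_coor_rV.
  by apply/funext => p; exact: coor_snoc_rV_lift.
rewrite (_ : _ \o _ = snd) //.
by apply/funext => p; exact: coor_snoc_rV_max.
Qed.

Lemma snoc_cons_rV n (x y : mR) (v : 'rV[R]_n) :
  snoc_rV (cons_rV (y, v), x) = cons_rV (y, snoc_rV (v, x)).
Proof.
have lmax : lift ord0 (ord_max : 'I_n.+1) = ord_max by exact/val_inj.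
have llift (k : 'I_n) : lift ord0 (lift ord_max k) = lift ord_max (lift ord0 k).
  by apply/val_inj; rewrite /= /bump /= !add1n ltnS addnS.
have l0 : lift ord_max ord0 = ord0 :> 'I_n.+2 by exact/val_inj.
apply/rowP => i; case: (unliftP ord0 i) => [j|] ->.
  rewrite coor_cons_rVS; case: (unliftP ord_max j) => [k|] ->.
    by rewrite coor_snoc_rV_lift llift coor_snoc_rV_lift coor_cons_rVS.
  by rewrite lmax !coor_snoc_rV_max.
by rewrite coor_cons_rV0 -l0 coor_snoc_rV_lift coor_cons_rV0.
Qed.

Lemma snoc_cons_rV0 (x : mR) (v : 'rV[R]_0) : snoc_rV (v, x) = cons_rV (x, v).
Proof.
have e0 : ord_max = ord0 :> 'I_1 by exact/val_inj.
apply/rowP => i; case: (unliftP ord_max i) => [[]//|->].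
by rewrite coor_snoc_rV_max e0 coor_cons_rV0.
Qed.

Local Open Scope ereal_scope.

Section cons_integral.
Variables (n : nat) (f : 'rV[R]_n.+1 -> \bar R).
Hypotheses (mf : measurable_fun [set: 'rV[R]_n.+1] f) (f0 : forall y, 0 <= f y).

Let fc : mR * 'rV[R]_n -> \bar R := f \o @cons_rV R n.

Let mfc : measurable_fun [set: mR * 'rV[R]_n] fc.
Proof. exact: (measurableT_comp mf (@measurable_cons_rV R n)). Qed.

Let fc0 p : 0 <= fc p. Proof. exact: f0. Qed.

Lemma integral_cons_rV :
  \int[mu n.+1]_y f y = \int[mu n]_v \int[leb]_x f (cons_rV (x, v)).
Proof.
transitivity (\int[pushforward (leb \x mu n) (@cons_rV R n)]_y f y); first by [].
rewrite ge0_integral_pushforward//; last exact: measurable_cons_rV.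
by rewrite preimage_setT; exact: fubini_tonelli2 mfc fc0.
Qed.

Lemma measurable_integral_cons_rV_head :
  measurable_fun [set: 'rV[R]_n] (fun v => \int[leb]_x f (cons_rV (x, v))).
Proof. exact: measurable_fun_fubini_tonelli_G mfc fc0. Qed.

Let fs : 'rV[R]_n * mR -> \bar R := f \o @snoc_rV n.

Lemma measurable_integral_snoc_rV :
  measurable_fun [set: 'rV[R]_n] (fun v => \int[leb]_x f (snoc_rV (v, x))).
Proof.
apply: (measurable_fun_fubini_tonelli_F fs) => [|p]; last exact: f0.
exact: (measurableT_comp mf (@measurable_snoc_rV n)).
Qed.

End cons_integral.

(** The Lebesgue measure of R^(n+1) is also the product of the Lebesgue measure
    of the first n coordinates with that of the last one. *)
Lemma integral_snoc_rV n (f : 'rV[R]_n.+1 -> \bar R) :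
  measurable_fun [set: 'rV[R]_n.+1] f -> (forall y, 0 <= f y) ->
  \int[mu n.+1]_y f y = \int[mu n]_v \int[leb]_x f (snoc_rV (v, x)).
Proof.
(* for n + 2: peel off the first coordinate, exchange it with the last one, and
   apply the induction hypothesis to the integral over the first coordinate *)
elim: n f => [|n IH] f mf f0.
  rewrite (integral_cons_rV mf f0); apply: eq_integral => v _.
  by apply: eq_integral => x _; rewrite snoc_cons_rV0.
pose h (v : 'rV[R]_n.+1) := \int[leb]_x f (snoc_rV (v, x)).
have h0 v : 0 <= h v by exact: integral_ge0.
have mh : measurable_fun [set: 'rV[R]_n.+1] h by exact: measurable_integral_snoc_rV.
pose k (y : 'rV[R]_n.+1) := \int[leb]_x f (cons_rV (x, y)).
have k0 v : 0 <= k v by exact: integral_ge0.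
have mk : measurable_fun [set: 'rV[R]_n.+1] k by exact: measurable_integral_cons_rV_head.
rewrite [RHS](integral_cons_rV mh h0) (integral_cons_rV mf f0).
rewrite (IH k mk k0); apply: eq_integral => v _.
rewrite /h /k.
pose g (p : mR * mR) := f (cons_rV (p.1, snoc_rV (v, p.2))).
have mg : measurable_fun [set: mR * mR] g.
  have mc : measurable_fun [set: mR * mR]
      (fun p => (p.1, snoc_rV (v, p.2)) : mR * 'rV[R]_n.+1).
    apply: measurable_fun_pair => //=.
    apply: (measurableT_comp (@measurable_snoc_rV n)).
    by apply: measurable_fun_pair => //=; exact: measurable_cst.
  exact: (measurableT_comp mf (measurableT_comp (@measurable_cons_rV R n.+1) mc)).
transitivity (\int[leb]_y \int[leb]_x g (x, y)); first by [].
have g0 p : 0 <= g p by exact: f0.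
rewrite -(fubini_tonelli g mg g0).
apply: eq_integral => y _; apply: eq_integral => x _.
by rewrite /g /= snoc_cons_rV.
Qed.

End lebesgue_rV_integrals.

(** * Invariance of dx / Pi(x) under the Lyness map *)

Section lyness_integral.
Context {R : realType}.
Local Notation mR := (measurableTypeR R).
Local Notation leb := (@lebesgue_measure R).
Local Notation mu n := (lebesgue_rV R n).
Implicit Type n : nat.

(** The density 1 / Pi(x), extended by 0 outside the orthant. *)
Definition dens n (x : 'rV[R]_n) : R := \prod_(i < n) omega (x ord0 i).

Lemma dens_ge0 n (x : 'rV[R]_n) : 0 <= dens x.
Proof. by apply: prodr_ge0 => i _; exact: omega_ge0. Qed.

Lemma measurable_dens n : measurable_fun [set: 'rV[R]_n] (@dens n).
Proof.
apply: measurable_prod => i _.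
exact: (measurableT_comp (@measurable_omega R) (@measurable_coor_rV R n i)).
Qed.

Lemma dens_cons n (x : mR) (v : 'rV[R]_n) :
  dens (cons_rV (x, v)) = omega x * dens v.
Proof.
rewrite /dens big_ord_recl coor_cons_rV0; congr (_ * _).
by apply: eq_bigr => i _; rewrite coor_cons_rVS.
Qed.

Lemma dens_snoc n (x : mR) (v : 'rV[R]_n) :
  dens (snoc_rV (v, x)) = dens v * omega x.
Proof.
rewrite /dens big_ord_recr/= coor_snoc_rV_max; congr (_ * _).
apply: eq_bigr => i _; rewrite -[RHS]/(omega ((v, x).1 ord0 i)).
rewrite -coor_snoc_rV_lift; congr (omega (_ _ _)); apply/val_inj => /=.
by rewrite /bump leqNgt ltn_ord.
Qed.

Lemma dens_orthant n (x : 'rV[R]_n.+1) : orthant x -> dens x = (lyness_Pi x)^-1.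
Proof.
move=> Qx; rewrite /lyness_Pi big_add1 big_mkord -prodfV; apply: eq_bigr => i _.
by rewrite /omega Qx crdE.
Qed.

Lemma dens_notin n (x : 'rV[R]_n) : ~ orthant x -> dens x = 0.
Proof.
move=> nQx; apply/eqP/negPn/negP; rewrite prodf_seq_neq0 => /allP w0.
apply: nQx => i; have := w0 i (mem_index_enum i); rewrite /= /omega.
by case: ifPn => //; rewrite eqxx.
Qed.

Lemma lyness_cons a n (x : mR) (v : 'rV[R]_n) :
  lyness a n (cons_rV (x, v)) = snoc_rV (v, (a + \sum_(i < n) v ord0 i) / x).
Proof.
have crdS i : (i < n)%N -> forall j : 'I_n, j = i :> nat ->
    crd (cons_rV (x, v)) i.+2 = v ord0 j.
  move=> i_n j ji; rewrite /crd /= (_ : inord i.+1 = lift ord0 j).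
    exact: coor_cons_rVS.
  by apply/val_inj; rewrite /= inordK ?ltnS// /bump /= ji.
apply/rowP => i; case: (unliftP ord_max i) => [j|] ->.
  rewrite coor_snoc_rV_lift mxE.
  have jE : lift ord_max j = j :> nat by rewrite /= /bump leqNgt ltn_ord.
  by rewrite jE ltn_ord; exact: crdS.
rewrite coor_snoc_rV_max mxE ltnn; congr ((_ + _) / _).
  rewrite big_add1 big_add1 big_mkord; apply: eq_bigr => j _.
  exact: crdS.
rewrite /crd /= (_ : inord 0 = ord0); first exact: coor_cons_rV0.
by apply/val_inj; rewrite /= inordK.
Qed.

Lemma measurable_crd n i : measurable_fun [set: 'rV[R]_n.+1]
  (fun x : 'rV[R]_n.+1 => crd x i : mR).
Proof. exact: measurable_coor_rV. Qed.

Let measurable_quotient a n (r : seq nat) i : measurable_fun [set: 'rV[R]_n.+1]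
  (fun x : 'rV[R]_n.+1 => (a + \sum_(j <- r) crd x j) / crd x i : mR).
Proof.
apply: measurable_funM.
  apply: measurable_funD => //; apply: measurable_sum => j.
  exact: measurable_crd.
by apply: measurable_funV; exact: measurable_crd.
Qed.

Lemma measurable_lyness a n :
  measurable_fun [set: 'rV[R]_n.+1] (lyness a n : _ -> 'rV[R]_n.+1).
Proof.
apply/measurable_fun_rVP => i; have [i_n|i_n] := boolP (i < n)%N.
  rewrite (_ : _ \o _ = fun x => crd x i.+2); first exact: measurable_crd.
  by apply/funext => x; rewrite /coor_rV /= mxE i_n.
rewrite (_ : _ \o _ =
  fun x => (a + \sum_(2 <= j < n.+2) crd x j) / crd x 1).
  exact: measurable_quotient.
by apply/funext => x; rewrite /coor_rV /= mxE (negbTE i_n).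
Qed.

Lemma measurable_lyness_inv a n :
  measurable_fun [set: 'rV[R]_n.+1] (@lyness_inv R n a).
Proof.
apply/measurable_fun_rVP => i; have [i0|i0] := boolP (i == 0%N :> nat).
  rewrite (_ : _ \o _ =
    fun x => (a + \sum_(1 <= j < n.+1) crd x j) / crd x n.+1).
    exact: measurable_quotient.
  by apply/funext => x; rewrite /coor_rV /= mxE i0.
rewrite (_ : _ \o _ = fun x => crd x i); first exact: measurable_crd.
by apply/funext => x; rewrite /coor_rV /= mxE (negbTE i0).
Qed.

Local Open Scope ereal_scope.

(** In the coordinates (x, v) of R x R^n the Lyness map is (x, v) |-> (v, S / x)
    with S depending only on v, and x |-> S / x preserves dx / x. *)
Lemma integral_lyness (a : R) n (f : 'rV[R]_n.+1 -> \bar R) :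
  (0 < n)%N -> (0 <= a)%R ->
  measurable_fun [set: 'rV[R]_n.+1] f -> (forall y, 0 <= f y) ->
  \int[mu n.+1]_y (f (lyness a n y) * (dens y)%:E) =
  \int[mu n.+1]_y (f y * (dens y)%:E).
Proof.
move=> n0 a0 mf f0.
have mdens : measurable_fun [set: 'rV[R]_n.+1] (EFin \o @dens n.+1).
  by apply/measurable_EFinP; exact: measurable_dens.
have mfl : measurable_fun [set: 'rV[R]_n.+1] (f \o lyness a n).
  exact: (measurableT_comp mf (@measurable_lyness a n)).
rewrite integral_cons_rV; last 2 first.
- exact: (emeasurable_funM mfl mdens).
- by move=> y; rewrite mule_ge0// lee_fin dens_ge0.
rewrite [RHS]integral_snoc_rV; last 2 first.
- exact: (emeasurable_funM mf mdens).
- by move=> y; rewrite mule_ge0// lee_fin dens_ge0.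
apply: eq_integral => v _.
under eq_integral do rewrite dens_cons lyness_cons EFinM muleA.
under [RHS]eq_integral do rewrite dens_snoc mulrC EFinM muleA.
have [Qv|nQv] := pselect (orthant v); last first.
  rewrite (dens_notin nQv).
  by under eq_integral do rewrite mule0;
     under [RHS]eq_integral do rewrite mule0.
have S0 : (0 < a + \sum_(i < n) v ord0 i)%R.
  case: n n0 {f mf f0 mdens mfl} v Qv => // n _ v Qv.
  rewrite big_ord_recl addrCA ltr_wpDr ?Qv// addr_ge0// sumr_ge0// => i _.
  by rewrite ltW// Qv.
pose g (x : mR) := f (snoc_rV (v, x)).
have mg : measurable_fun [set: mR] g.
  apply: (measurableT_comp mf); apply: (measurableT_comp (@measurable_snoc_rV R n)).
  by apply: measurable_fun_pair => //; exact: measurable_cst.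
have mgw : measurable_fun [set: mR] (fun x => g x * (omega x)%:E).
  by apply: emeasurable_funM => //; apply/measurable_EFinP; exact: measurable_omega.
pose s := (a + \sum_(i < n) v ord0 i)%R.
have ms : measurable_fun [set: mR] (fun x : mR => s / x : mR)%R.
  by apply: measurable_funM => //; exact: measurable_inv.
have mgsw : measurable_fun [set: mR] (fun x => g (s / x)%R * (omega x)%:E).
  apply: emeasurable_funM; first exact: (measurableT_comp mg ms).
  by apply/measurable_EFinP; exact: measurable_omega.
rewrite ge0_integralZr//; last 2 first.
- by move=> x _; rewrite mule_ge0 ?f0// lee_fin omega_ge0.
- by rewrite lee_fin dens_ge0.
rewrite [RHS]ge0_integralZr//; last 2 first.
- by move=> x _; rewrite mule_ge0 ?f0// lee_fin omega_ge0.
- by rewrite lee_fin dens_ge0.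
congr (_ * _); apply: (integral_inversion S0 mg) => x; exact: f0.
Qed.

End lyness_integral.

(** * Invariant measures of the second iterate *)

Section lyness_invariant_measure.
Context {R : realType} (n : nat) (a : R).
Hypothesis n_gt0 : (0 < n)%N.
Hypothesis a_ge0 : 0 <= a.
Local Notation F := (lyness a n).
Local Notation Fi := (@lyness_inv R n a).
Local Notation Q := (@orthant R n.+1).
Local Notation mu := (lebesgue_rV R n.+1).
Local Notation L := (lebesgue_space R n.+1).
Local Notation lam := (complete_lebesgue R n.+1).

Lemma measurable_orthant m : measurable (@orthant R m).
Proof.
have := @measurable_box_rV R m (fun=> `]0, +oo[%classic).
rewrite (_ : mkset _ = @orthant R m); first by apply.
apply/seteqP; split=> x Qx i.
  by have := Qx i; rewrite /= in_itv/= andbT.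
by rewrite /= in_itv/= andbT; exact: Qx.
Qed.

Lemma image_lynessE (A : set 'rV[R]_n.+1) :
  A `<=` Q -> F @` A = Q `&` Fi @^-1` A.
Proof.
move=> AQ; apply/seteqP; split=> [_ [x Ax <-]|y [Qy Ay]].
  by split; [apply: lyness_orthant => //; exact: AQ|rewrite /= lynessK//; exact: AQ].
by exists (Fi y) => //; exact: lyness_invK.
Qed.

Lemma measurable_image_lyness (A : set 'rV[R]_n.+1) :
  A `<=` Q -> measurable A -> measurable (F @` A).
Proof.
move=> AQ mA; rewrite image_lynessE//; apply: measurableI.
  exact: measurable_orthant.
by rewrite -[X in measurable X]setTI; exact: measurable_lyness_inv.
Qed.

Let image_mem (A : set 'rV[R]_n.+1) y : A `<=` Q -> Q y -> (F @` A) (F y) = A y.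
Proof.
move=> AQ Qy; apply/propext; split=> [[x Ax FxFy]|Ay]; last by exists y.
by rewrite -(lynessK n_gt0 a_ge0 Qy) -FxFy lynessK//; exact: AQ.
Qed.

Local Open Scope ereal_scope.

Lemma integral_image_lyness (A : set 'rV[R]_n.+1) (q : 'rV[R]_n.+1 -> R) :
  A `<=` Q -> measurable A ->
  measurable_fun [set: 'rV[R]_n.+1] q -> (forall y, (0 <= q y)%R) ->
  \int[mu]_(y in F @` A) (q y * dens y)%:E =
  \int[mu]_(y in A) (q (F y) * dens y)%:E.
Proof.
move=> AQ mA mq q0; have mFA := measurable_image_lyness AQ mA.
pose f y := (q y * \1_(F @` A) y)%:E.
have f0 y : 0 <= f y by rewrite lee_fin mulr_ge0.
have mf : measurable_fun [set: 'rV[R]_n.+1] f.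
  by apply/measurable_EFinP; apply: measurable_funM => //; exact: measurable_indic.
rewrite integral_mkcond [RHS]integral_mkcond.
transitivity (\int[mu]_y (f y * (dens y)%:E)).
  apply: eq_integral => y _; rewrite /f patchE indicE.
  by case: ifPn => _; rewrite -EFinM ?mulr1// mulr0 mul0r.
rewrite -(integral_lyness n_gt0 a_ge0 mf f0); apply: eq_integral => y _.
rewrite /f patchE indicE -EFinM.
have [Qy|nQy] := pselect (Q y); last first.
  rewrite (dens_notin nQy) !mulr0; case: ifPn => //.
rewrite (_ : (F y \in F @` A) = (y \in A)).
  by case: ifPn => _; rewrite ?mulr1// mulr0 mul0r.
by apply/idP/idP => /set_mem H; apply/mem_set; move: H; rewrite image_mem.
Qed.

(** The density 1 / Pi is positive, so that F preserves null sets. *)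
Lemma null_image_lyness (N : set 'rV[R]_n.+1) :
  N `<=` Q -> measurable N -> mu N = 0 -> mu (F @` N) = 0.
Proof.
move=> NQ mN N0; have mFN := measurable_image_lyness NQ mN.
have mdens D : measurable_fun D (EFin \o @dens R n.+1).
  by apply: measurable_funTS; apply/measurable_EFinP; exact: measurable_dens.
have dens0 : \int[mu]_(y in F @` N) `|(EFin \o @dens R n.+1) y| = 0.
  have := @integral_image_lyness N (cst 1%R) NQ mN (measurable_cst _) (fun=> ler01).
  under eq_integral do rewrite mul1r.
  under [RHS]eq_integral do rewrite mul1r.
  under [X in _ -> X = _]eq_integral do rewrite /= ger0_norm ?dens_ge0//.
  move=> ->; under eq_integral do rewrite -[(dens _)%R]ger0_norm ?dens_ge0//.
  by rewrite -[RHS](integral_abs_eq0 mN (mdens N) N0); apply: eq_integral.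
have [M [mM M0 NM]] := (ae_eq_integral_abs mu mFN (mdens _)).1 dens0.
apply: (subset_measure0 mFN mM _ M0) => y FNy; apply: NM => /= /(_ FNy)[].
apply/eqP; rewrite gt_eqF//.
have Qy : Q y by move: FNy => [x Nx <-]; apply: lyness_orthant => //; exact: NQ.
by rewrite dens_orthant// invr_gt0 lyness_Pi_gt0.
Qed.

(** The Lyness map preserves the Lebesgue-measurable sets of the orthant, since
    it preserves its Borel sets and its null sets. *)
Lemma complete_integral_image_lyness (B : set L) (q : 'rV[R]_n.+1 -> R) :
  B `<=` Q -> measurable B ->
  measurable_fun [set: 'rV[R]_n.+1] q -> (forall y, (0 <= q y)%R) ->
  measurable (F @` B : set L) /\
  \int[lam]_(y in (F @` B : set L)) (q y * dens y)%:E =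
  \int[lam]_(y in B) (q (F y) * dens y)%:E.
Proof.
move=> BQ mB mq q0.
have [A [N [mA mN AB BAN N0]]] := caratheodory_decomposition mB.
have AQ := subset_trans AB BQ.
pose N' := N `&` Q.
have mN' : measurable N' by apply: measurableI => //; exact: measurable_orthant.
have N'Q : N' `<=` Q by exact: subIsetr.
have N'0 : mu N' = 0 by apply: (subset_measure0 mN' mN _ N0); exact: subIsetl.
have BAN' : B `\` A `<=` N' by move=> x BAx; split; [exact: BAN|apply: BQ; case: BAx].
have mFA := measurable_image_lyness AQ mA.
have mFN := measurable_image_lyness N'Q mN'.
have FAB : F @` A `<=` F @` B by exact: image_subset.
have FBAN : (F @` B) `\` (F @` A) `<=` F @` N'.
  move=> y [[x Bx FxE] nFA]; exists x => //; apply: BAN'; split=> // Ax.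
  by apply: nFA; exists x.
have FN0 := null_image_lyness N'Q mN' N'0.
have mw (p : 'rV[R]_n.+1 -> R) : measurable_fun [set: 'rV[R]_n.+1] p ->
    measurable_fun [set: 'rV[R]_n.+1] (fun y => (p y * dens y)%:E).
  by move=> mp; apply/measurable_EFinP; apply: measurable_funM => //; exact: measurable_dens.
have mqF : measurable_fun [set: 'rV[R]_n.+1] (fun y => q (F y)).
  exact: (measurableT_comp mq (@measurable_lyness R a n)).
split; first exact: (caratheodory_compose mFA mFN).
transitivity (\int[mu]_(y in F @` A) (q y * dens y)%:E).
  apply: (ge0_integral_caratheodory mFA mFN FAB FBAN FN0); first exact: mw.
  by move=> y; rewrite lee_fin mulr_ge0// dens_ge0.
rewrite integral_image_lyness//; symmetry.
apply: (ge0_integral_caratheodory mA mN' AB BAN' N'0).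
  exact: (mw (fun y => q (F y)) mqF).
by move=> y; rewrite lee_fin mulr_ge0// dens_ge0.
Qed.

(** Every measure of density q / Pi, with q invariant by the second iterate of F,
    is invariant by this iterate. *)
Lemma invariant_measure_lyness2 (D : set 'rV[R]_n.+1)
    (q g : 'rV[R]_n.+1 -> R) :
  D `<=` Q -> (forall x, D x -> D (F (F x))) ->
  measurable_fun [set: 'rV[R]_n.+1] q -> (forall y, (0 <= q y)%R) ->
  (forall x, Q x -> q (F (F x)) = q x) ->
  (forall x, D x -> g x = q x * dens x)%R ->
  invariant_measure (T := L) D (F \o F)
    (fun B : set L => \int[lam]_(x in B) (g x)%:E).
Proof.
move=> DQ DF mq q0 qF gE.
have gint (B : set L) : B `<=` D ->
    \int[lam]_(x in B) (g x)%:E = \int[lam]_(x in B) (q x * dens x)%:E.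
  by move=> BD; apply: eq_integral => x /set_mem/BD Dx; rewrite gE.
split.
  have mw : measurable_fun [set: L] (fun x : L => q x * @dens R n.+1 x)%R.
    apply: measurable_fun_caratheodory; apply: measurable_funM => //.
    exact: measurable_dens.
  have w0 (x : L) : (0 <= q x * @dens R n.+1 x)%R by rewrite mulr_ge0// dens_ge0.
  by exists (mdensity lam mw w0) => B mB BD; rewrite gint.
move=> B mB BD; have BQ := subset_trans BD DQ.
have FBQ : F @` B `<=` Q.
  by move=> _ [x Bx <-]; apply: lyness_orthant => //; exact: BQ.
have mqF : measurable_fun [set: 'rV[R]_n.+1] (fun y => q (F y)).
  exact: (measurableT_comp mq (@measurable_lyness R a n)).
have [mFB intFB] := complete_integral_image_lyness BQ mB mqF (fun y => q0 (F y)).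
have [mFFB intFFB] := complete_integral_image_lyness FBQ mFB mq q0.
have FFBE : (F \o F) @` B = F @` (F @` B) by rewrite image_comp.
rewrite FFBE; split=> //.
rewrite gint; last by rewrite -FFBE => _ [x Bx <-]; apply: DF; exact: BD.
rewrite intFFB intFB gint//; apply: eq_integral => x /set_mem Bx.
by rewrite qF//; exact: BQ.
Qed.

End lyness_invariant_measure.

Section lyness_odd_measures.
Context {R : realType} (l : nat) (a : R).
Hypothesis l_gt0 : (0 < l)%N.
Hypothesis a_ge0 : 0 <= a.
Local Notation F := (lyness a l.*2).
Local Notation W := (lyness_W l).
Local Notation Q := (@orthant R l.*2.+1).
Local Notation L := (lebesgue_space R l.*2.+1).

Let n_gt0 : (0 < l.*2)%N. Proof. by rewrite double_gt0. Qed.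

Lemma measurable_lyness_W : measurable_fun [set: 'rV[R]_(l.*2.+1)] W.
Proof.
apply: measurable_funM; first last.
  apply: measurable_funV; apply: measurable_prod => i _; exact: measurable_crd.
by apply: measurable_prod => i _; apply: measurable_funD => //; exact: measurable_crd.
Qed.

Lemma invariant_lyness_m2 : invariant_measure (T := L) Q (F \o F) (lyness_m2 l).
Proof.
apply: (invariant_measure_lyness2 n_gt0 a_ge0 (q := cst 1)) => //.
- by move=> x Qx; do 2 apply: lyness_orthant => //.
- by move=> x Qx; rewrite dens_orthant.
Qed.

Let q (x : 'rV[R]_(l.*2.+1)) := `|(W x - W (F x))^-1|.

Let mq : measurable_fun [set: 'rV[R]_(l.*2.+1)] q.
Proof.
apply: measurableT_comp => //; apply: measurable_funV; apply: measurable_funB.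
  exact: measurable_lyness_W.
exact: (measurableT_comp measurable_lyness_W (@measurable_lyness R a l.*2)).
Qed.

Let qF x : Q x -> q (F (F x)) = q x.
Proof.
move=> Qx; rewrite /q !lyness_W_lyness2//; exact: lyness_orthant.
Qed.

Lemma invariant_lyness_m1_pos :
  invariant_measure (T := L) (lyness_Gpos a l) (F \o F) (lyness_m1 a l 1).
Proof.
apply: (invariant_measure_lyness2 n_gt0 a_ge0 (q := q)) => //.
- by move=> x [].
- move=> x Gx; rewrite -(image_lyness_Gneg l_gt0 a_ge0); exists (F x) => //.
  by rewrite -(image_lyness_Gpos l_gt0 a_ge0); exists x.
- by move=> y; exact: normr_ge0.
- move=> x [Qx Wx]; rewrite dens_orthant// /q gtr0_norm ?invr_gt0//.
  by rewrite mul1r invfM mulrC.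
Qed.

Lemma invariant_lyness_m1_neg :
  invariant_measure (T := L) (lyness_Gneg a l) (F \o F) (lyness_m1 a l (-1)).
Proof.
apply: (invariant_measure_lyness2 n_gt0 a_ge0 (q := q)) => //.
- by move=> x [].
- move=> x Gx; rewrite -(image_lyness_Gpos l_gt0 a_ge0); exists (F x) => //.
  by rewrite -(image_lyness_Gneg l_gt0 a_ge0); exists x.
- by move=> y; exact: normr_ge0.
- move=> x [Qx]; rewrite oppr_gt0 => Wx.
  rewrite dens_orthant// /q ltr0_norm ?invr_lt0//.
  by rewrite mulN1r invfM mulrC mulNr.
Qed.

End lyness_odd_measures.

Theorem theorem2 (R : realType) (l : nat) (hl : (1 <= l)%N)
    (a : R) (ha : 0 <= a) :
  let F : 'rV[R]_(l.*2.+1) -> 'rV[R]_(l.*2.+1) := lyness a l.*2 in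
  let Q : set 'rV[R]_(l.*2.+1) := orthant (R := R) (n := l.*2.+1) in
  let W : 'rV[R]_(l.*2.+1) -> R := lyness_W l in
  let V1 : 'rV[R]_(l.*2.+1) -> R := lyness_V1 a l.*2 in
  let V2 : 'rV[R]_(l.*2.+1) -> R := lyness_V2 a l.*2 in
  let V3 : 'rV[R]_(l.*2.+1) -> R := lyness_V3 a l in
  let G := lyness_G a l in
  let Gpos := lyness_Gpos a l in
  let Gneg := lyness_Gneg a l in
  (* (a) *)
  first_integral Q (F \o F) W /\
  (* (b) *)
  ((2 <= l)%N ->
    [/\ (forall x, Q x -> V3 x =
          (\prod_(0 <= j < l.+1) (crd x j.*2.+1 * (crd x j.*2.+1 + 1))
           + (a + \sum_(1 <= j < l.*2.+2) crd x j)
             * \prod_(1 <= j < l.+1) (crd x j.*2 * (crd x j.*2 + 1)))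
          / \prod_(1 <= i < l.*2.+2) crd x i),
        first_integral Q F V3,
        first_integral Q F V1,
        first_integral Q F V2 &
        functionally_independent Q (tnth [tuple V1; V2; V3])]) /\
  (* (c) *)
  (forall x, Q x -> V1 x = W x * W (F x)) /\
  (* (d) *)
  invariant_set F G /\
  (* (e) *)
  (forall (p : nat) x, odd p -> Q x -> iter p F x = x -> G x) /\
  (* (f) *)
  [/\ F @` Gpos `<=` Gneg, F @` Gneg `<=` Gpos,
      invariant_set (F \o F) Gpos, invariant_set (F \o F) Gneg &
      conjugation Gpos (F \o F) Gneg (F \o F) F] /\
  (* (g) *)
  (invariant_measure (T := lebesgue_space R l.*2.+1)
     Gpos (F \o F) (lyness_m1 a l 1) /\
   invariant_measure (T := lebesgue_space R l.*2.+1)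
     Gneg (F \o F) (lyness_m1 a l (-1))) /\
  (* (h) *)
  invariant_measure (T := lebesgue_space R l.*2.+1)
    Q (F \o F) (lyness_m2 l).
Proof.
move=> F Q W V1 V2 V3 G Gpos Gneg; split; first exact: first_integral_W.
split.
  move=> l2; split.
  - exact: lyness_V3E.
  - exact: first_integral_V3.
  - exact: first_integral_V1.
  - exact: first_integral_V2.
  - exact: independent_V1_V2_V3.
split; first exact: lyness_V1E.
split; first exact: invariant_lyness_G.
split; first exact: odd_period_lyness_G.
split.
  have FGpos : F @` Gpos = Gneg := image_lyness_Gpos hl ha.
  have FGneg : F @` Gneg = Gpos := image_lyness_Gneg hl ha.
  split; [by rewrite FGpos|by rewrite FGneg| | |exact: conjugation_lyness].
  - by rewrite /invariant_set -image_comp FGpos.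
  - by rewrite /invariant_set -image_comp FGneg.
split; last exact: invariant_lyness_m2.
by split; [exact: invariant_lyness_m1_pos|exact: invariant_lyness_m1_neg].
Qed.
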